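(* Let $K$ be an uncountable compact metric space and let $d\in \mathbb{N}^+$. Then for a prevalent $f\in C(K,\mathbb{R}^d)$ we have \[ \dim_P \operatorname{graph}(f)=\dim_P K+d. \]
   Context: $C(K,\mathbb{R}^d)$ is the Banach space of continuous maps $K\to\mathbb{R}^d$ with the maximum norm, viewed as an abelian Polish group. A set $A\subset G$ in an abelian Polish group is shy if there exist a Borel set $B\supset A$ and a Borel probability measure $\mu$ on $G$ with $\mu(B+x)=0$ for all $x\in G$; prevalent means complement shy; ''for a prevalent $f$'' means the set of such $f$ contains a prevalent set. $K\times\mathbb{R}^d$ carries the metric $\sqrt{\rho(x_1,x_2)^2+|z_1-z_2|^2}$ and $\operatorname{graph}(f)=\{(x,f(x)):x\in K\}$. $N_n(X)$ is the maximal cardinality of a subset of $X$ with pairwise distances $>2^{-n}$; $\overline{\dim}_B X=\limsup_n\frac{\log N_n(X)}{n\log 2}$ for non-empty totally bounded $X$ (and $\infty$ otherwise); packing dimension is $\dim_P X=\inf\{\sup_i\overline{\dim}_B A_i: X\subset\bigcup_{i=1}^\infty A_i\}$. *)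

(* Defs.v *)
From Stdlib Require Import Reals List Classical ClassicalEpsilon FunctionalExtensionality.
Open Scope R_scope.

Inductive Rbar : Type := Finite (r : R) | p_infty | m_infty.

Definition Rbar_le (x y : Rbar) : Prop :=
  match x, y with
  | m_infty, _ => True
  | _, p_infty => True
  | Finite a, Finite b => a <= b
  | _, _ => False
  end.

Definition Rbar_plus (x y : Rbar) : Rbar :=
  match x, y with
  | Finite a, Finite b => Finite (a + b)
  | p_infty, _ | _, p_infty => p_infty
  | _, _ => m_infty
  end.

Definition real_of_Rbar (x : Rbar) : R :=
  match x with Finite r => r | _ => 0 end.

Definition is_lub_Rbar (P : Rbar -> Prop) (s : Rbar) : Prop :=
  (forall x, P x -> Rbar_le x s) /\
  (forall b, (forall x, P x -> Rbar_le x b) -> Rbar_le s b).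
Definition is_glb_Rbar (P : Rbar -> Prop) (s : Rbar) : Prop :=
  (forall x, P x -> Rbar_le s x) /\
  (forall b, (forall x, P x -> Rbar_le b x) -> Rbar_le b s).

(** supremum / infimum in [-oo,+oo] (they always exist; chosen by epsilon) *)
Definition Rbar_sup (P : Rbar -> Prop) : Rbar :=
  epsilon (inhabits p_infty) (is_lub_Rbar P).
Definition Rbar_inf (P : Rbar -> Prop) : Rbar :=
  epsilon (inhabits p_infty) (is_glb_Rbar P).

Definition Rbar_limsup (u : nat -> Rbar) : Rbar :=
  Rbar_inf (fun v => exists N : nat,
     v = Rbar_sup (fun w => exists n, (N <= n)%nat /\ w = u n)).

Definition is_metric {X : Type} (dist : X -> X -> R) : Prop :=
  (forall x y, 0 <= dist x y) /\
  (forall x y, dist x y = 0 <-> x = y) /\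
  (forall x y, dist x y = dist y x) /\
  (forall x y z, dist x z <= dist x y + dist y z).

Definition m_open {X : Type} (dist : X -> X -> R) (U : X -> Prop) : Prop :=
  forall x, U x -> exists eps, 0 < eps /\ forall y, dist x y < eps -> U y.

Definition m_compact {X : Type} (dist : X -> X -> R) : Prop :=
  forall (I : Type) (U : I -> X -> Prop),
    (forall i, m_open dist (U i)) ->
    (forall x, exists i, U i x) ->
    exists l : list I, forall x, exists i, In i l /\ U i x.

Definition uncountable (X : Type) : Prop :=
  ~ exists f : X -> nat, forall x y, f x = f y -> x = y.

Definition nonempty_set {Y : Type} (S : Y -> Prop) : Prop := exists y, S y.

Definition totally_bounded {Y : Type} (dist : Y -> Y -> R) (S : Y -> Prop) : Prop :=
  forall eps, 0 < eps -> exists l : list Y,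
    forall y, S y -> exists c, In c l /\ dist y c < eps.

Definition separated_list {Y : Type} (dist : Y -> Y -> R) (S : Y -> Prop)
  (n : nat) (l : list Y) : Prop :=
  NoDup l /\ (forall y, In y l -> S y) /\
  (forall y z, In y l -> In z l -> y <> z -> dist y z > (/2) ^ n).

Definition N_sep {Y : Type} (dist : Y -> Y -> R) (S : Y -> Prop) (n : nat) : Rbar :=
  Rbar_sup (fun v => exists l, separated_list dist S n l /\ v = Finite (INR (length l))).

Definition upper_box_dim {Y : Type} (dist : Y -> Y -> R) (S : Y -> Prop) : Rbar :=
  match excluded_middle_informative (nonempty_set S /\ totally_bounded dist S) with
  | left _ => Rbar_limsup (fun n =>
       Finite (ln (real_of_Rbar (N_sep dist S n)) / (INR n * ln 2)))
  | right _ => p_infty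
  end.

Definition packing_dim {Y : Type} (dist : Y -> Y -> R) (S : Y -> Prop) : Rbar :=
  Rbar_inf (fun v => exists A : nat -> Y -> Prop,
     (forall y, S y -> exists i, A i y) /\
     v = Rbar_sup (fun w => exists i, w = upper_box_dim dist (A i))).

(** * R^d, represented by nat -> R using the coordinates 0..d-1 *)
Fixpoint sumsq (d : nat) (z : nat -> R) : R :=
  match d with O => 0 | S k => sumsq k z + z k ^ 2 end.
Definition vnorm (d : nat) (z : nat -> R) : R := sqrt (sumsq d z).

Definition graph_dist {X : Type} (rho : X -> X -> R) (d : nat)
  (p q : X * (nat -> R)) : R :=
  sqrt (rho (fst p) (fst q) ^ 2 + vnorm d (fun i => snd p i - snd q i) ^ 2).

Definition graph {X : Type} (f : X -> nat -> R) : X * (nat -> R) -> Prop :=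
  fun p => exists x, p = (x, f x).

Definition inC {X : Type} (rho : X -> X -> R) (d : nat) (f : X -> nat -> R) : Prop :=
  (forall x i, (d <= i)%nat -> f x i = 0) /\
  (forall x eps, 0 < eps -> exists delta, 0 < delta /\
     forall y, rho x y < delta -> vnorm d (fun i => f y i - f x i) < eps).

Definition cdist {X : Type} (d : nat) (f g : X -> nat -> R) : R :=
  real_of_Rbar (Rbar_sup (fun v => exists x, v = Finite (vnorm d (fun i => f x i - g x i)))).

Definition C_open {X : Type} (rho : X -> X -> R) (d : nat)
  (U : (X -> nat -> R) -> Prop) : Prop :=
  (forall f, U f -> inC rho d f) /\
  (forall f, U f -> exists eps, 0 < eps /\
     forall g, inC rho d g -> cdist d f g < eps -> U g).

Inductive C_Borel {X : Type} (rho : X -> X -> R) (d : nat) :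
    ((X -> nat -> R) -> Prop) -> Prop :=
  | Borel_open U : C_open rho d U -> C_Borel rho d U
  | Borel_compl A : C_Borel rho d A -> C_Borel rho d (fun f => inC rho d f /\ ~ A f)
  | Borel_union (A : nat -> (X -> nat -> R) -> Prop) :
      (forall n, C_Borel rho d (A n)) -> C_Borel rho d (fun f => exists n, A n f).

Definition Borel_prob {X : Type} (rho : X -> X -> R) (d : nat)
  (mu : ((X -> nat -> R) -> Prop) -> R) : Prop :=
  mu (inC rho d) = 1 /\
  (forall B, C_Borel rho d B -> 0 <= mu B) /\
  (forall A : nat -> (X -> nat -> R) -> Prop,
     (forall n, C_Borel rho d (A n)) ->
     (forall m n f, m <> n -> A m f -> A n f -> False) ->
     Un_cv (fun N => sum_f_R0 (fun n => mu (A n)) N) (mu (fun f => exists n, A n f))).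

Definition translate {X : Type} (B : (X -> nat -> R) -> Prop) (h : X -> nat -> R) :
  (X -> nat -> R) -> Prop :=
  fun g => exists b, B b /\ g = (fun x i => b x i + h x i).

Definition shy {X : Type} (rho : X -> X -> R) (d : nat) (A : (X -> nat -> R) -> Prop) : Prop :=
  exists (B : (X -> nat -> R) -> Prop) (mu : ((X -> nat -> R) -> Prop) -> R),
    C_Borel rho d B /\ (forall f, A f -> B f) /\ Borel_prob rho d mu /\
    (forall h, inC rho d h -> mu (translate B h) = 0).

Definition prevalent {X : Type} (rho : X -> X -> R) (d : nat) (P : (X -> nat -> R) -> Prop) : Prop :=
  (forall f, P f -> inC rho d f) /\ shy rho d (fun f => inC rho d f /\ ~ P f).

(* Main.v *)
(** The upper bound holds for every continuous [f]: a box cover of [A] in [K] at scale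
    [2 ^ (-n)] lifts to the graph over [A] with at most [O (2 ^ (n d))] boxes per box.

    For the lower bound the probe measure is the law of [x |-> (t_1 g_1 x, ..., t_d g_d x)]
    with [t] uniform in the cube [[0, 1] ^ d] and one fixed [g], generic in the sense of Baire.
    Let [s < dim_P K]. Removing from [K] all basic open sets that are countable unions of
    points and sets of upper box dimension at most [s] leaves a nonempty compact kernel [C]
    each of whose nonempty relatively open subsets [S] is perfect and has upper box
    dimension larger than [s].  So at infinitely many scales [2 ^ (-n)] there are
    [2 ^ (n s)] separated points in [S], and near each of them a generic [g] maps about
    [2 ^ (n d)] points of [S] onto a cubic grid of small but fixed side.  For every
    translation [h], two points whose grid labels are [m] and [m'] have values of
    [t g - h] within [2 ^ (-n)] of each other with probability at most the product over
    the coordinates with [m_i <> m'_i] of [c / |m_i - m'_i|], where [c] is twice the ratio of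
    [2 ^ (-n)] to the mesh; summing over the grid and applying Markov's inequality,
    at least half of the points have no such partner.  Hence almost surely the graph
    over [S] has upper box dimension at least [s + d], and a Baire argument in [C]
    carries this over to the packing dimension. *)

(* The harmonic sum over the grid costs a factor of order [n], so a mesh comparable to 2^(-n) would
   not suffice. The grid has 2^k labels per axis with [k] slightly below [n]: the gain 2^(n-k) beats
   this factor, while the loss in the exponent stays below any given [eta]. Collisions are counted
   only inside a cluster, as points of different clusters are already separated in [K]; hence the
   expected number of partners of a point does not depend on the number of clusters. Shyness asks
   for a single measure, so one [g] must serve all levels [s] and all base sets at once; this is why
   it is found by category. A translation [h] moves the intervals to which the [t_i] are confined
   but not their lengths, which makes the estimate uniform in [h]. The exceptional set has to be
   Borel: it is a countable union of complements of open conditions, each asking for one finite list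
   with strict separation inequalities. If [dim_P K = 0], negative levels [s] are used, and the
   kernel becomes the perfect kernel of Cantor and Bendixson. *)
Require Import Defs.
From Stdlib Require Import ZArith Reals List Classical ClassicalEpsilon.
From Stdlib Require Import FunctionalExtensionality PropExtensionality Lra Lia Cantor.
From mathcomp Require all_boot all_order all_algebra.
From mathcomp Require all_classical all_reals all_analysis.
From mathcomp Require measurable_realfun Rstruct Rstruct_topology.
Open Scope R_scope.

(** * Uniform measure on the cube *)

Fixpoint rprod (d : nat) (F : nat -> R) : R :=
  match d with O => 1 | S k => rprod k F * F k end.

(* [lam] lives on infinite sequences, of which only the first [d] coordinates matter. *)
Record cube_law (d : nat) (Meas : ((nat -> R) -> Prop) -> Prop)
  (lam : ((nat -> R) -> Prop) -> R) : Prop := {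
  cl_compl : forall A, Meas A -> Meas (fun t => ~ A t);
  cl_union : forall A : nat -> (nat -> R) -> Prop,
    (forall n, Meas (A n)) -> Meas (fun t => exists n, A n t);
  cl_open : forall A : (nat -> R) -> Prop,
    (forall t, A t -> exists e, 0 < e /\
       forall u, (forall i, (i < d)%nat -> Rabs (u i - t i) < e) -> A u) ->
    Meas A;
  cl_ge0 : forall A, Meas A -> 0 <= lam A;
  cl_full : lam (fun _ => True) = 1;
  cl_sigma : forall A : nat -> (nat -> R) -> Prop,
    (forall n, Meas (A n)) ->
    (forall m n t, m <> n -> A m t -> A n t -> False) ->
    Un_cv (fun N => sum_f_R0 (fun n => lam (A n)) N) (lam (fun t => exists n, A n t));
  cl_box : forall (B : nat -> bool) (lo hi : nat -> R), (forall i, lo i <= hi i) ->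
    lam (fun t => forall i, (i < d)%nat -> B i = true -> lo i <= t i <= hi i) <=
    rprod d (fun i => if B i then hi i - lo i else 1) }.

Module CubeMeasure.
Import all_boot all_order all_algebra all_classical all_reals all_analysis.
Import measurable_realfun Rstruct Rstruct_topology.
Import Order.TTheory GRing.Theory Num.Theory numFieldNormedType.Exports.
Local Open Scope classical_set_scope.
Local Open Scope ring_scope.

(** The density is at most 1. Equality can fail because the interval may stick out of [0, 1]. *)
Lemma uniform_itv_le (R : realType) (lo hi : R) : lo <= hi ->
  (uniform_prob (@ltr01 R) `[lo, hi]%classic <= (hi - lo)%:E)%E.
Proof.
move=> lohi; rewrite /uniform_prob integral_uniform_pdf.
apply: (@le_trans _ _ (\int[lebesgue_measure]_(x in `[lo, hi] `&` `[0%R, 1%R]) (cst 1%:E x))%E).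
  apply: ge0_le_integral => //=.
  - exact: measurableI.
  - by move=> x _; rewrite lee_fin uniform_pdf_ge0.
  - by apply/measurable_EFinP/measurable_funTS; exact: measurable_uniform_pdf.
  - move=> x [_]; rewrite /= in_itv/= /uniform_pdf => ->.
    by rewrite subr0 invr1.
rewrite integral_cst/=; last exact: measurableI.
rewrite mul1e; apply: le_trans (_ : (lebesgue_measure `[lo, hi]%classic <= _)%E).
  by rewrite le_measure ?inE//; exact: measurableI.
rewrite lebesgue_measure_itv/= lte_fin; case: ifP => //= _.
by rewrite lee_fin subr_ge0.
Qed.

Lemma measurable_box (R : realType) dd (T : measurableType dd) (c : T -> nat -> R)
    (n : nat) (B : nat -> bool) (lo hi : nat -> R) :
  (forall i, measurable_fun setT (fun t => c t i)) ->
  measurable [set t | forall i, (i < n)%N -> B i -> lo i <= c t i <= hi i].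
Proof.
move=> mc; rewrite (_ : [set _ | _] = \bigcap_(i in [set i | (i < n)%N /\ B i])
    ((fun t => c t i) @^-1` `[lo i, hi i])); last first.
  apply/seteqP; split=> t h i.
    by move=> [ilt Bi] /=; rewrite in_itv /=; apply: h.
  by move=> ilt Bi; have := h i (conj ilt Bi); rewrite /= in_itv.
apply: bigcap_measurableType => i _; rewrite -[X in measurable X]setTI.
by apply: mc => //; exact: measurable_itv.
Qed.

(** Each new coordinate multiplies the sample space by one more factor, so independence is that of
    the product measure. The sample space stays abstract; [cube_law_exists] pushes its law forward
    along [c]. *)
Lemma cube_space (R : realType) (n : nat) :
  exists (dd : measure_display) (T : measurableType dd) (P : probability T R)
    (c : T -> nat -> R),
    (forall i, measurable_fun setT (fun t => c t i)) /\
    forall (B : nat -> bool) (lo hi : nat -> R), (forall i, lo i <= hi i) ->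
    (P [set t | forall i, (i < n)%N -> B i -> (lo i <= c t i <= hi i)%R] <=
      (\prod_(i < n) (if B i then hi i - lo i else 1))%:E)%E.
Proof.
elim: n => [|n [dd [T [P [c [mc hP]]]]]].
  exists _, (measurableTypeR R), (uniform_prob (@ltr01 R)), (fun _ _ => 0).
  split=> [i|B lo hi _]; first exact: measurable_cst.
  rewrite big_ord0; apply: probability_le1; apply: measurable_box => i.
  exact: measurable_cst.
pose T' := (T * measurableTypeR R)%type.
exists _, T', (P \x uniform_prob (@ltr01 R))%E,
  (fun (t : T') i => if i == n then t.2 else c t.1 i).
split=> [i|B lo hi lohi].
  case: eqP => _; first exact: measurable_snd.
  by apply: (measurableT_comp (mc i)); exact: measurable_fst.
pose A := [set t | forall i, (i < n)%N -> B i -> lo i <= c t i <= hi i].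
pose J : set (measurableTypeR R) := if B n then `[lo n, hi n]%classic else setT.
rewrite (_ : [set _ | _] = A `*` J); last first.
  apply/seteqP; split=> [[t u]|[t u]] /=.
    move=> h; split=> /=.
      move=> i ilt Bi; have := h i (ltnW ilt) Bi.
      by rewrite (ltn_eqF ilt).
    rewrite /J; case: ifP => // Bn; have := h n (ltnSn n) Bn.
    by rewrite eqxx /= in_itv.
  move=> [At Ju] i; rewrite ltnS leq_eqVlt => /orP[/eqP-> Bn|ilt Bi].
    by rewrite eqxx; move: Ju; rewrite /J /= Bn /= in_itv.
  by rewrite (ltn_eqF ilt); apply: At.
have mA : measurable A by exact: measurable_box.
have mJ : measurable J by rewrite /J; case: ifP => // _; exact: measurable_itv.
rewrite big_ord_recr/= EFinM.
apply: (@le_trans _ _ (P A * uniform_prob (@ltr01 R) J)%E).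
  by rewrite -product_measure1E.
apply: lee_pmul => //; first exact: hP.
rewrite /J; case: ifP => _; first exact: uniform_itv_le.
exact: probability_le1.
Qed.

Lemma rprodE n (F : nat -> R) : rprod n F = \prod_(i < n) F i.
Proof. by elim: n => [|n ih]; rewrite ?big_ord0// big_ord_recr/= -ih. Qed.

Theorem cube_law_exists (d : nat) : exists Meas lam, cube_law d Meas lam.
Proof.
have [dd [T [P [c [mc hP]]]]] := cube_space R d.
pose pre (A : (nat -> R) -> Prop) : set T := [set t | A (c t)].
exists (fun A => measurable (pre A)), (fun A => fine (P (pre A))).
have fP A : measurable (pre A) -> P (pre A) \is a fin_num.
  by move=> mA; rewrite fin_num_measure.
split.
- by move=> A mA; exact: measurableC.
- move=> A mA; rewrite (_ : pre _ = \bigcup_n pre (A n)); first exact: bigcupT_measurable.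
  by apply/seteqP; split=> t [n]; [exists n|move=> ?; exists n].
- move=> A oA.
  (* Measurability of [c] is known only coordinate by coordinate, so an open set is written as the
     countable union of the rational boxes inside it. A radius below [e / 2] leaves room for the
     distance from [c t] to the rational centre. *)
  pose box (q : d.-tuple rat * rat) (t : nat -> R) :=
    forall i : 'I_d, `|t i - ratr (tnth q.1 i)| < ratr q.2.
  pose good q := forall u, box q u -> A u.
  rewrite (_ : pre A = \bigcup_(q in good) pre (box q)); last first.
    apply/seteqP; split=> [t /oA[e [/RltP e0 he]]|t [q gq] /gq//].
    have [r /=] := rat_in_itvoo (divr_gt0 e0 (ltr0n _ 2)).
    rewrite in_itv/= => /andP[r0 re].
    have hq (i : 'I_d) : exists q : rat, `|c t i - ratr q| < ratr r.
      have /rat_in_itvoo[q] : c t i - ratr r < c t i + ratr r.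
        by rewrite ltrD2l gtrN.
      rewrite in_itv/= => /andP[h1 h2]; exists q.
      by rewrite distrC ltr_distl h1.
    pose q := [tuple xget 0 [set q : rat | `|c t i - ratr q| < ratr r] | i < d].
    exists (q, r) => [u ub|i]; last first.
      rewrite tnth_mktuple; case: (hq i) => s hs.
      by have := @xgetI _ 0 [set q : rat | `|c t i - ratr q| < ratr r] _ hs.
    apply: he => i /ssrnat.ltP ilt; apply/RltP.
    have /= := ub (Ordinal ilt); rewrite tnth_mktuple /= => h1.
    case: (hq (Ordinal ilt)) => s hs.
    have /= h2 := @xgetI _ 0 [set q : rat | `|c t i - ratr q| < ratr r] _ hs.
    rewrite RabsE.
    have -> (x y : R) : (x - y)%coqR = x - y by [].
    apply: le_lt_trans (ler_distD (ratr (xget 0 [set q : rat | `|c t i - ratr q| < ratr r])) _ _) _.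
    rewrite [X in _ < X](splitr e) ltrD//.
      exact: lt_trans h1 _.
    by rewrite distrC; exact: lt_trans h2 _.
  rewrite bigcup_mkcond; apply: countable_bigcupT_measurable.
    exact: countableP.
  move=> q; case: ifP => // _.
  rewrite (_ : pre _ = \bigcap_(i in [set i | (i < d)%N])
    ((fun t => c t i) @^-1` [set x | forall ilt : (i < d)%N, `|x - ratr (tnth q.1 (Ordinal ilt))| < ratr q.2])); last first.
    apply/seteqP; split=> [t h i ilt ilt'|t h i]; first exact: (h (Ordinal ilt')).
    case: i => i ilt; exact: (h i ilt ilt).
  apply: bigcap_measurableType => i /= ilt; rewrite -[X in measurable X]setTI.
  apply: mc => //.
  rewrite (_ : [set _ | _] = ball (ratr (tnth q.1 (Ordinal ilt)) : R) (ratr q.2)).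
    exact: measurable_ball.
  apply/seteqP; split=> x /=.
    by move=> /(_ ilt); rewrite /ball /= distrC.
  by rewrite /ball/= distrC => h ilt'; rewrite (bool_irrelevance ilt' ilt).
- by move=> A mA; apply/RleP; rewrite fine_ge0.
- by rewrite (_ : pre _ = setT) ?probability_setT.
- move=> A mA dA.
  have /= := @measure_semi_sigma_additive _ _ _ P (fun n => pre (A n)) mA.
  have tA : trivIset setT (fun n => pre (A n)).
    apply/trivIsetP => m n _ _ /eqP mn; rewrite -subset0 => t [] /= Am An.
    exact: (dA m n (c t) mn Am An).
  move=> /(_ tA (bigcupT_measurable _ mA)).
  rewrite (_ : \bigcup_n pre (A n) = pre (fun t => exists n, A n t)); last first.
    by apply/seteqP; split=> t [n]; [exists n|exists n].
  have mU : measurable (pre (fun t => exists n, A n t)).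
    rewrite (_ : pre _ = \bigcup_n pre (A n)); first exact: bigcupT_measurable.
    by apply/seteqP; split=> t [n]; [exists n|move=> ?; exists n].
  rewrite -[X in _ --> X](fineK (fP _ mU)) => /fine_cvgP[_ /cvgrPdist_lt h] e /RltP e0.
  have [N _ hN] := h e e0.
  exists N => n /ssrnat.leP Nn; apply/RltP.
  (* [sum_f_R0] includes its last index, so its value at [n] is the partial sum of [n.+1] terms. *)
  have := hN n.+1 (leqW Nn); rewrite /= distrC /R_dist RabsE RminusE.
  rewrite (_ : fine _ = sum_f_R0 (fun n => fine (P (pre (A n)))) n) //.
  elim: n {Nn} => [|n ih]; first by rewrite big_nat1.
  rewrite big_nat_recr//= fineD ?ih//; last exact: fP.
  by apply/sum_fin_numP => i _ _; exact: fP.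
- move=> B lo hi lohi; apply/RleP; rewrite rprodE.
  have := hP B lo hi (fun i => introT RleP (lohi i)).
  have := erefl (pre (fun t => forall i, (i < d)%coq_nat -> B i = true -> (lo i <= t i <= hi i)%coqR)).
  rewrite {1}(_ : pre _ = [set t | forall i, (i < d)%N -> B i -> (lo i <= c t i <= hi i)%R]); last first.
    apply/seteqP; split=> t h i /ssrnat.ltP ilt Bi.
      by have [/RleP -> /RleP ->] := h i ilt Bi.
    by have /andP[/RleP ? /RleP ?] := h i ilt Bi.
  set X := pre _ => XE.
  have mX : measurable X by rewrite -XE; exact: measurable_box.
  by rewrite XE -(fineK (fP _ mX)) lee_fin.
Qed.

End CubeMeasure.

(** * Extended reals *)

Lemma Rbar_le_refl x : Rbar_le x x.
Proof. destruct x; simpl; auto; lra. Qed.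

Lemma Rbar_le_trans x y z : Rbar_le x y -> Rbar_le y z -> Rbar_le x z.
Proof. destruct x, y, z; simpl; auto; try tauto; lra. Qed.

Lemma Rbar_le_antisym x y : Rbar_le x y -> Rbar_le y x -> x = y.
Proof. destruct x, y; simpl; try tauto; intros; f_equal; lra. Qed.

Lemma Rbar_le_total x y : Rbar_le x y \/ Rbar_le y x.
Proof. destruct x, y; simpl; auto; lra. Qed.

(** If [w] is [p_infty] nothing has to be tested, and if it is [m_infty] every real is a test; so
    later proofs argue with real bounds only. *)
Lemma Rbar_le_of_real_bounds b w :
  (forall v, Rbar_le w (Finite v) -> Rbar_le b (Finite v)) -> Rbar_le b w.
Proof.
  intros H. destruct w as [r| |].
  - apply H, Rbar_le_refl.
  - destruct b; exact I.
  - destruct b as [r| |]; simpl; auto.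
    + specialize (H (r - 1) I). simpl in H. lra.
    + exact (H 0 I).
Qed.

Lemma Rbar_sup_lub P : is_lub_Rbar P (Rbar_sup P).
Proof.
  unfold Rbar_sup, Rbar_inf; apply epsilon_spec.
  destruct (classic (exists M, forall x, P x -> Rbar_le x (Finite M))) as [[M HM]|Hn].
  - destruct (classic (exists r, P (Finite r))) as [[r0 Hr0]|Hr].
    + destruct (completeness (fun r => P (Finite r))) as [s [Hs1 Hs2]].
      * exists M. intros r Hr. exact (HM _ Hr).
      * exists r0; auto.
      * exists (Finite s). split.
        -- intros [r| |] Hx; simpl; auto. exact (HM _ Hx).
        -- intros [b| |] Hb; simpl; auto.
           ++ apply Hs2. intros r Hr. exact (Hb _ Hr).
           ++ exact (Hb _ Hr0).
    + exists m_infty. split; [|intros; exact I].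
      intros [r| |] Hx; simpl; auto; [apply Hr; eauto | exact (HM _ Hx)].
  - exists p_infty. split; [intros []; simpl; auto|].
    intros [b| |] Hb; simpl; auto; apply Hn; [exists b; auto|].
    exists 0. intros x Hx. specialize (Hb x Hx). destruct x; simpl in *; tauto.
Qed.

Lemma Rbar_inf_glb P : is_glb_Rbar P (Rbar_inf P).
Proof.
  unfold Rbar_sup, Rbar_inf; apply epsilon_spec.
  destruct (Rbar_sup_lub (fun b => forall x, P x -> Rbar_le b x)) as [H1 H2].
  eexists. split; [|exact H1].
  intros x Hx. apply H2. auto.
Qed.

Lemma Rbar_limsup_le_iff (a : nat -> R) (v : R) :
  Rbar_le (Rbar_limsup (fun n => Finite (a n))) (Finite v) <->
  forall e, 0 < e -> exists N, forall n, (N <= n)%nat -> a n <= v + e.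
Proof.
  unfold Rbar_limsup.
  destruct (Rbar_inf_glb (fun x => exists N : nat,
     x = Rbar_sup (fun w => exists n, (N <= n)%nat /\ w = Finite (a n)))) as [G1 G2].
  set (L := Rbar_inf _) in *. split.
  - intros HL e He. apply NNPP. intros Hn.
    assert (Rbar_le (Finite (v + e)) L) as Hc.
    { apply G2. intros x [N ->].
      destruct (Rbar_le_total (Finite (v + e)) (Rbar_sup (fun w => exists n, (N <= n)%nat /\ w = Finite (a n)))) as [h|h]; auto.
      exfalso. apply Hn. exists N. intros n Hln.
      destruct (Rbar_sup_lub (fun w => exists n, (N <= n)%nat /\ w = Finite (a n))) as [S1 _].
      exact (Rbar_le_trans _ _ _ (S1 (Finite (a n)) (ex_intro _ n (conj Hln eq_refl))) h). }
    pose proof (Rbar_le_trans _ _ _ Hc HL) as h. simpl in h. lra.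
  - intros H.
    assert (forall e, 0 < e -> Rbar_le L (Finite (v + e))) as HL.
    { intros e He. destruct (H e He) as [N HN].
      eapply Rbar_le_trans; [apply G1; exists N; reflexivity|].
      apply (proj2 (Rbar_sup_lub _)). intros x [n [Hn ->]]. simpl. auto. }
    destruct L as [r| |]; simpl; auto.
    + apply Rnot_lt_le. intros h. specialize (HL ((r - v) / 2) ltac:(lra)). simpl in HL. lra.
    + apply (HL 1); lra.
Qed.

(** * Lists *)

Lemma length_le_of_injection {A B} (phi : A -> B) (l : list A) (l' : list B) :
  NoDup l -> (forall x, In x l -> In (phi x) l') ->
  (forall x y, In x l -> In y l -> phi x = phi y -> x = y) ->
  (length l <= length l')%nat.
Proof.
  intros Hl Hin Hinj. rewrite <- (length_map phi). apply NoDup_incl_length.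
  - induction l as [|a l IH]; simpl; constructor; inversion Hl; subst.
    + intros h. apply in_map_iff in h as [y [h1 h2]].
      rewrite (Hinj y a) in h2; simpl; auto.
    + apply IH; auto; intros; simpl in *; auto.
  - intros y h. apply in_map_iff in h as [x [<- h]]. auto.
Qed.

Lemma injection_between_lists {A B} (l : list A) (l' : list B) (b0 : B) :
  NoDup l' -> (length l <= length l')%nat -> NoDup l ->
  exists phi : A -> B, (forall x, In x l -> In (phi x) l') /\
    (forall x y, In x l -> In y l -> phi x = phi y -> x = y).
Proof.
  intros Hl'. revert l. induction Hl' as [|b l' Hb Hl' IH]; intros [|a l] Hlen Hl;
    simpl in Hlen; try lia; try (exists (fun _ => b0); simpl; tauto).
  inversion Hl; subst. destruct (IH l) as [phi [H1' H2']]; auto; try lia.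
  exists (fun x => if excluded_middle_informative (x = a) then b else phi x). split.
  - intros x [<-|Hx]; destruct (excluded_middle_informative _); simpl; auto; try tauto.
  - intros x y Hx Hy.
    destruct (excluded_middle_informative (x = a)), (excluded_middle_informative (y = a));
      subst; auto.
    + destruct Hy as [<-|Hy]; [tauto|]. intros h. exfalso. apply Hb. rewrite h. auto.
    + destruct Hx as [<-|Hx]; [tauto|]. intros h. exfalso. apply Hb. rewrite <- h. auto.
    + destruct Hx as [<-|Hx], Hy as [<-|Hy]; try tauto. auto.
Qed.

Lemma list_uniform_radius {A} (l : list A) (Q : A -> R -> Prop) :
  (forall a r r', In a l -> Q a r -> 0 < r' <= r -> Q a r') ->
  (forall a, In a l -> exists r, 0 < r /\ Q a r) ->
  exists r, 0 < r /\ forall a, In a l -> Q a r.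
Proof.
  induction l as [|a l IH]; intros Hm H.
  - exists 1. split; [lra|]. intros a [].
  - destruct IH as [r [Hr1 Hr2]].
    + intros; eapply Hm; eauto; simpl; auto.
    + intros; apply H; simpl; auto.
    + destruct (H a) as [s [Hs1 Hs2]]; [simpl; auto|].
      exists (Rmin r s). pose proof (Rmin_l r s). pose proof (Rmin_r r s).
      assert (0 < Rmin r s) by (apply Rmin_pos; auto).
      split; auto. intros b [<-|Hb]; eapply Hm; eauto; simpl; auto.
Qed.

Lemma list_uniform_nat {A} (l : list A) (Q : A -> nat -> Prop) :
  (forall a n m, Q a n -> (n <= m)%nat -> Q a m) ->
  (forall a, In a l -> exists n, Q a n) ->
  exists n, forall a, In a l -> Q a n.
Proof.
  intros Hm. induction l as [|a l IH]; intros H.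
  - exists 0%nat. intros a [].
  - destruct IH as [n Hn]; [intros; apply H; simpl; auto|].
    destruct (H a) as [k Hk]; [simpl; auto|].
    exists (max n k). intros b [<-|Hb]; eapply Hm; eauto; lia.
Qed.

Lemma NoDup_list_prod {A B} (l : list A) (l' : list B) :
  NoDup l -> NoDup l' -> NoDup (list_prod l l').
Proof.
  intros Hl Hl'. induction Hl as [|a l Ha Hl IH]; simpl; [constructor|].
  apply NoDup_app; auto.
  - apply NoDup_map_NoDup_ForallPairs; auto. intros x y _ _ e. congruence.
  - intros p Hp Hq. apply in_map_iff in Hp as [b [<- _]].
    apply in_prod_iff in Hq as [Hq _]. auto.
Qed.

Lemma NoDup_list_of_unbounded {A} (P : A -> Prop) :
  (forall l, exists x, P x /\ ~ In x l) ->
  forall T, exists l, NoDup l /\ length l = T /\ forall x, In x l -> P x.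
Proof.
  intros H T. induction T as [|T [l [H1 [H2 H3]]]].
  - exists nil. split; [constructor|]. simpl; tauto.
  - destruct (H l) as [x [Hx Hn]]. exists (x :: l).
    split; [constructor; auto|]. simpl. split; [lia|]. intros y [<-|Hy]; auto.
Qed.

(** * Separated sets and the upper box dimension *)

Definition pseudometric {Y} (dist : Y -> Y -> R) : Prop :=
  (forall x, dist x x = 0) /\ (forall x y, dist x y = dist y x) /\
  (forall x y z, dist x z <= dist x y + dist y z).

Lemma Rabs_le_inv x a : Rabs x <= a -> - a <= x <= a.
Proof. unfold Rabs. destruct (Rcase_abs x); lra. Qed.

Lemma pow_half_pos n : 0 < (/2) ^ n.
Proof. apply pow_lt. lra. Qed.

Lemma pow_half_small e : 0 < e -> exists n, (/2) ^ n < e.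
Proof.
  intros He. destruct (pow_lt_1_zero (/2) ltac:(rewrite Rabs_right; lra) e He) as [n Hn].
  exists n. specialize (Hn n (le_n n)). rewrite Rabs_right in Hn; auto.
  apply Rle_ge, Rlt_le, pow_half_pos.
Qed.

Section UpperBoxDim.
Context {Y : Type} (dist : Y -> Y -> R) (Hd : pseudometric dist).

(** Two separated points cannot share a centre of a net whose radius is half the separation. *)
Lemma separated_bounded S : totally_bounded dist S ->
  forall n, exists M, forall l, separated_list dist S n l -> (length l <= M)%nat.
Proof.
  destruct Hd as [_ [Hs Ht]].
  intros Htb n. destruct (Htb ((/2) ^ n / 2)) as [cs Hcs].
  { pose proof (pow_half_pos n). lra. }
  exists (length cs). intros l [Hl1 [Hl2 Hl3]].
  destruct (choice (fun y c => S y -> In c cs /\ dist y c < (/2) ^ n / 2)) as [phi Hphi].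
  { intros y. destruct (classic (S y)) as [h|h].
    - destruct (Hcs y h) as [c Hc]. exists c; auto.
    - exists y; tauto. }
  apply (length_le_of_injection phi); auto.
  - intros x Hx. apply Hphi; auto.
  - intros x y Hx Hy e. apply NNPP. intros hn.
    pose proof (Hl3 x y Hx Hy hn).
    destruct (Hphi x (Hl2 x Hx)) as [_ h1]. destruct (Hphi y (Hl2 y Hy)) as [_ h2].
    pose proof (Ht x (phi x) y). rewrite e in *. rewrite (Hs y) in h2. lra.
Qed.

(** A longest separated list is a net: a point far from all its entries could be added to it. *)
Lemma maximal_separated S n M :
  (forall l, separated_list dist S n l -> (length l <= M)%nat) ->
  exists l, separated_list dist S n l /\
    (forall l', separated_list dist S n l' -> (length l' <= length l)%nat) /\
    forall y, S y -> exists z, In z l /\ dist y z <= (/2) ^ n.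
Proof.
  intros HM.
  assert (exists l, separated_list dist S n l /\
    forall l', separated_list dist S n l' -> (length l' <= length l)%nat) as [l [Hl Hmax]].
  { apply NNPP. intros Hn.
    assert (forall k, exists l, separated_list dist S n l /\ (k <= length l)%nat) as Hk.
    { induction k as [|k [l [Hl1 Hl2]]].
      - exists nil. split; [|simpl; lia]. split; [constructor|]. simpl; tauto.
      - apply NNPP. intros Hn2. apply Hn. exists l. split; auto.
        intros l' Hl'. apply Nat.nlt_ge. intros h. apply Hn2. exists l'. split; auto. lia. }
    destruct (Hk (M + 1)%nat) as [l [h1 h2]]. specialize (HM l h1). lia. }
  exists l. split; auto. split; auto.
  intros y Hy. apply NNPP. intros Hn.
  assert (forall z, In z l -> dist y z > (/2) ^ n) as Hfar.
  { intros z Hz. apply Rnot_le_gt. intros h. apply Hn; eauto. }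
  destruct Hd as [H0 [Hs _]].
  assert (separated_list dist S n (y :: l)) as Hy'.
  { destruct Hl as [Hl1 [Hl2 Hl3]]. split; [|split].
    - constructor; auto. intros h. specialize (Hfar y h). rewrite H0 in Hfar.
      pose proof (pow_half_pos n). lra.
    - intros z [<-|Hz]; auto.
    - intros a b [<-|Ha] [<-|Hb] hab; auto; try tauto. rewrite Hs. auto. }
  specialize (Hmax _ Hy'). simpl in Hmax. lia.
Qed.

Lemma totally_bounded_of_separated S :
  (forall n, exists M, forall l, separated_list dist S n l -> (length l <= M)%nat) ->
  totally_bounded dist S.
Proof.
  intros H e He. destruct (pow_half_small e He) as [n Hn].
  destruct (H n) as [M HM]. destruct (maximal_separated S n M HM) as [l [_ [_ Hl]]].
  exists l. intros y Hy. destruct (Hl y Hy) as [z [h1 h2]]. exists z. split; auto. lra.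
Qed.

Lemma separated_singleton (S : Y -> Prop) n y : S y -> separated_list dist S n (y :: nil).
Proof.
  intros Hy. split; [|split].
  - constructor; [simpl; tauto|constructor].
  - intros z [<-|[]]; auto.
  - intros a b [<-|[]] [<-|[]]; tauto.
Qed.

Lemma N_sep_max S n : nonempty_set S -> totally_bounded dist S ->
  exists l, separated_list dist S n l /\ N_sep dist S n = Finite (INR (length l)) /\
    (1 <= length l)%nat /\
    forall l', separated_list dist S n l' -> (length l' <= length l)%nat.
Proof.
  intros [y Hy] Htb. destruct (separated_bounded S Htb n) as [M HM].
  destruct (maximal_separated S n M HM) as [l [Hl [Hmax _]]].
  exists l. split; auto. split; [|split; auto].
  - unfold N_sep. apply Rbar_le_antisym.
    + apply (proj2 (Rbar_sup_lub _)). intros x [l' [Hl' ->]]. simpl. apply le_INR; auto.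
    + apply (proj1 (Rbar_sup_lub _)). eauto.
  - apply (Hmax (y :: nil)). apply separated_singleton; auto.
Qed.

Lemma INR_le_Rpower_iff N n c : (1 <= N)%nat -> (1 <= n)%nat ->
  ln (INR N) / (INR n * ln 2) <= c <-> INR N <= Rpower 2 (INR n * c).
Proof.
  intros HN Hn.
  assert (0 < ln 2) by (rewrite <- ln_1; apply ln_increasing; lra).
  assert (0 < INR n) by (apply lt_0_INR; lia).
  assert (0 < INR N) by (apply lt_0_INR; lia).
  assert (0 < INR n * ln 2) by nra.
  assert (ln (INR N) / (INR n * ln 2) <= c <-> ln (INR N) <= INR n * c * ln 2) as ->.
  { split; intros h.
    - replace (ln (INR N)) with (ln (INR N) / (INR n * ln 2) * (INR n * ln 2)) by (field; split; lra).
      apply Rmult_le_compat_r with (r := INR n * ln 2) in h; lra.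
    - apply Rmult_le_reg_r with (INR n * ln 2); auto.
      unfold Rdiv. rewrite Rmult_assoc, Rinv_l; lra. }
  unfold Rpower. split; intros h.
  - rewrite <- (exp_ln (INR N)) at 1 by auto.
    destruct h as [h|h]; [left; apply exp_increasing; auto| right; congruence].
  - apply Rnot_lt_le. intros h2. apply exp_increasing in h2.
    rewrite exp_ln in h2; auto. lra.
Qed.

Lemma Rpower2_le x y : x <= y -> Rpower 2 x <= Rpower 2 y.
Proof. intros h. apply Rle_Rpower; lra. Qed.

(** Empty sets and sets that are not totally bounded have dimension [p_infty], so a real bound
    carries both properties along. *)
Lemma upper_box_dim_le_iff S v :
  Rbar_le (upper_box_dim dist S) (Finite v) <->
  nonempty_set S /\ totally_bounded dist S /\
  forall e, 0 < e -> exists N, forall n l, (N <= n)%nat -> separated_list dist S n l ->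
    INR (length l) <= Rpower 2 (INR n * (v + e)).
Proof.
  unfold upper_box_dim.
  destruct (excluded_middle_informative _) as [[H1 H2]|Hn]; [|simpl; tauto].
  rewrite Rbar_limsup_le_iff. split.
  - intros H. split; auto. split; auto. intros e He. destruct (H e He) as [N HN].
    (* The shift by one avoids [n = 0], where the quotient in the definition has denominator 0. *)
    exists (N + 1)%nat. intros n l Hn Hl.
    specialize (HN n ltac:(lia)).
    destruct (N_sep_max S n H1 H2) as [l0 [_ [E [Hl0 Hmax]]]].
    rewrite E in HN. simpl in HN. apply INR_le_Rpower_iff in HN; auto; [|lia].
    eapply Rle_trans; [|apply HN]. apply le_INR; auto.
  - intros [_ [_ H]] e He. destruct (H e He) as [N HN].
    exists (N + 1)%nat. intros n Hn.
    destruct (N_sep_max S n H1 H2) as [l0 [Hs [E [Hl0 Hmax]]]].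
    rewrite E. simpl. apply INR_le_Rpower_iff; auto; [lia|].
    apply HN; auto. lia.
Qed.

(** A nonempty set contains a separated singleton at every scale, while a negative exponent would
    push the bound below 1. *)
Lemma upper_box_dim_nonneg S v : Rbar_le (upper_box_dim dist S) (Finite v) -> 0 <= v.
Proof.
  intros H. apply upper_box_dim_le_iff in H as [[y Hy] [_ H]].
  apply Rnot_lt_le. intros hv. destruct (H (- v / 2) ltac:(lra)) as [N HN].
  specialize (HN (N + 1)%nat (y :: nil) ltac:(lia) (separated_singleton S _ y Hy)).
  simpl length in HN. assert (0 < INR (N + 1)) by (apply lt_0_INR; lia).
  assert (Rpower 2 (INR (N + 1) * (v + - v / 2)) < Rpower 2 0).
  { apply Rpower_lt; [lra|nra]. }
  rewrite Rpower_O in *; simpl in HN; lra.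
Qed.

Lemma upper_box_dim_singleton (S : Y -> Prop) y v : 0 <= v -> S y ->
  (forall x, S x -> x = y) -> Rbar_le (upper_box_dim dist S) (Finite v).
Proof.
  intros Hv Hy Hu.
  assert (forall n l, separated_list dist S n l -> (length l <= 1)%nat) as Hlen.
  { intros n l [H1 [H2 H3]]. destruct l as [|a [|b l]]; simpl; try lia.
    exfalso. inversion H1; subst. apply H4. left.
    rewrite (Hu a), (Hu b); simpl in *; auto. }
  apply upper_box_dim_le_iff. split; [exists y; auto|]. split.
  - apply totally_bounded_of_separated. eauto.
  - intros e He. exists 0%nat. intros n l _ Hl.
    apply Rle_trans with (Rpower 2 0).
    + rewrite Rpower_O by lra. apply (le_INR _ 1). eauto.
    + apply Rpower2_le. pose proof (pos_INR n). nra.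
Qed.

Lemma upper_box_dim_not_le S s : nonempty_set S -> totally_bounded dist S ->
  ~ Rbar_le (upper_box_dim dist S) (Finite s) ->
  forall N, exists n l, (N <= n)%nat /\ separated_list dist S n l /\
    Rpower 2 (INR n * s) <= INR (length l).
Proof.
  intros H1 H2 Hn N. apply NNPP. intros Hc. apply Hn.
  apply upper_box_dim_le_iff. split; auto. split; auto.
  intros e He. exists N. intros n l hn hl. apply Rnot_lt_le. intros h.
  apply Hc. exists n, l. split; auto. split; auto.
  eapply Rle_trans; [|left; exact h]. apply Rpower2_le. pose proof (pos_INR n). nra.
Qed.

Lemma packing_dim_le (S : Y -> Prop) (A : nat -> Y -> Prop) b :
  (forall y, S y -> exists i, A i y) ->
  (forall i, Rbar_le (upper_box_dim dist (A i)) b) -> Rbar_le (packing_dim dist S) b.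
Proof.
  intros Hc Hb. unfold packing_dim.
  eapply Rbar_le_trans; [apply (proj1 (Rbar_inf_glb _)); exists A; split; [exact Hc|reflexivity]|].
  apply (proj2 (Rbar_sup_lub _)). intros x [i ->]. auto.
Qed.

Lemma packing_dim_ge (S : Y -> Prop) b :
  (forall (A : nat -> Y -> Prop) v, (forall y, S y -> exists i, A i y) ->
    (forall i, Rbar_le (upper_box_dim dist (A i)) (Finite v)) -> Rbar_le b (Finite v)) ->
  Rbar_le b (packing_dim dist S).
Proof.
  intros H. apply (proj2 (Rbar_inf_glb _)). intros x [A [HA ->]].
  apply Rbar_le_of_real_bounds. intros v Hv. apply (H A v HA).
  intros i. eapply Rbar_le_trans; [|exact Hv]. apply (proj1 (Rbar_sup_lub _)). eauto.
Qed.

End UpperBoxDim.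

(** * Norms *)

(** Both [vnorm] and [graph_dist] are iterations of this norm of the plane, so the triangle
    inequality is proved in dimension two and inherited. *)
Definition hypot (a b : R) : R := sqrt (a ^ 2 + b ^ 2).

Lemma hypot_sqr a b : hypot a b ^ 2 = a ^ 2 + b ^ 2.
Proof. unfold hypot. apply pow2_sqrt. nra. Qed.

Lemma hypot_nonneg a b : 0 <= hypot a b.
Proof. apply sqrt_pos. Qed.

Lemma le_hypot_of_sqr x a b : x ^ 2 <= a ^ 2 + b ^ 2 -> x <= hypot a b.
Proof. intros h. pose proof (hypot_nonneg a b). pose proof (hypot_sqr a b). nra. Qed.

Lemma hypot_le_of_sqr x a b : 0 <= x -> a ^ 2 + b ^ 2 <= x ^ 2 -> hypot a b <= x.
Proof. intros h0 h. pose proof (hypot_nonneg a b). pose proof (hypot_sqr a b). nra. Qed.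

Lemma hypot_triangle a b c e : hypot (a + c) (b + e) <= hypot a b + hypot c e.
Proof.
  pose proof (hypot_nonneg a b). pose proof (hypot_nonneg c e).
  pose proof (hypot_sqr a b). pose proof (hypot_sqr c e).
  apply hypot_le_of_sqr; [lra|].
  assert (a * c + b * e <= hypot a b * hypot c e); [|nra].
  apply Rnot_lt_le. intros h.
  assert ((hypot a b * hypot c e) ^ 2 < (a * c + b * e) ^ 2).
  { apply pow_incr_lt || (assert (0 <= hypot a b * hypot c e) by nra; nra). }
  rewrite Rpow_mult_distr in H3. rewrite H1, H2 in H3.
  (* Cauchy-Schwarz from Lagrange's identity: (a^2 + b^2)(c^2 + e^2) - (ac + be)^2 = (ae - bc)^2. *)
  pose proof (pow2_ge_0 (a * e - b * c)). nra.
Qed.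

Lemma hypot_monotone a b a' b' : 0 <= a <= a' -> Rabs b <= Rabs b' -> hypot a b <= hypot a' b'.
Proof.
  intros h1 h2. apply hypot_le_of_sqr; [apply hypot_nonneg|]. rewrite hypot_sqr.
  rewrite <- (pow2_abs b), <- (pow2_abs b'). pose proof (Rabs_pos b). nra.
Qed.

Lemma hypot_le_plus a b : hypot a b <= Rabs a + Rabs b.
Proof.
  pose proof (Rabs_pos a). pose proof (Rabs_pos b). apply hypot_le_of_sqr; [lra|].
  rewrite <- (pow2_abs a), <- (pow2_abs b). nra.
Qed.

Lemma sumsq_nonneg d z : 0 <= sumsq d z.
Proof. induction d; simpl; [lra|]. nra. Qed.

Lemma vnorm_S d z : vnorm (S d) z = hypot (vnorm d z) (z d).
Proof.
  unfold vnorm, hypot. simpl sumsq. f_equal. rewrite pow2_sqrt; auto. apply sumsq_nonneg.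
Qed.

Lemma vnorm_nonneg d z : 0 <= vnorm d z.
Proof. apply sqrt_pos. Qed.

Lemma vnorm_ext d z z' : (forall i, (i < d)%nat -> z i = z' i) -> vnorm d z = vnorm d z'.
Proof.
  intros H. unfold vnorm. f_equal. induction d; simpl; auto.
  rewrite IHd, (H d); auto.
Qed.

Lemma coord_le_vnorm d z i : (i < d)%nat -> Rabs (z i) <= vnorm d z.
Proof.
  induction d; intros hi; [lia|]. rewrite vnorm_S.
  destruct (Nat.eq_dec i d) as [->|hn].
  - apply le_hypot_of_sqr. rewrite pow2_abs. nra.
  - eapply Rle_trans; [apply IHd; lia|]. apply le_hypot_of_sqr. nra.
Qed.

Lemma vnorm_le_coord d z c : 0 <= c -> (forall i, (i < d)%nat -> Rabs (z i) <= c) ->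
  vnorm d z <= INR d * c.
Proof.
  intros hc. induction d; intros h.
  - unfold vnorm. simpl. rewrite sqrt_0. lra.
  - rewrite vnorm_S, S_INR. eapply Rle_trans; [apply hypot_le_plus|].
    rewrite Rabs_right by (apply Rle_ge, vnorm_nonneg).
    assert (vnorm d z <= INR d * c) by (apply IHd; intros; apply h; lia).
    specialize (h d (Nat.lt_succ_diag_r d)). lra.
Qed.

Lemma vnorm_zero d z : (forall i, (i < d)%nat -> z i = 0) -> vnorm d z = 0.
Proof.
  intros h. apply Rle_antisym; [|apply vnorm_nonneg].
  replace 0 with (INR d * 0) by ring. apply vnorm_le_coord; [lra|].
  intros i hi. rewrite h, Rabs_R0; auto. lra.
Qed.

Lemma vnorm_triangle d z z' : vnorm d (fun i => z i + z' i) <= vnorm d z + vnorm d z'.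
Proof.
  induction d.
  - unfold vnorm. simpl. rewrite sqrt_0. lra.
  - rewrite !vnorm_S. eapply Rle_trans; [|apply hypot_triangle].
    apply hypot_monotone; [|lra]. split; [apply vnorm_nonneg|auto].
Qed.

Lemma vnorm_dist_triangle d (a b c : nat -> R) :
  vnorm d (fun i => a i - c i) <= vnorm d (fun i => a i - b i) + vnorm d (fun i => b i - c i).
Proof.
  eapply Rle_trans; [|apply vnorm_triangle]. right. apply vnorm_ext. intros. ring.
Qed.

Lemma vnorm_dist_sym d (a b : nat -> R) :
  vnorm d (fun i => a i - b i) = vnorm d (fun i => b i - a i).
Proof.
  unfold vnorm. f_equal. induction d; simpl; auto. rewrite IHd. ring.
Qed.

(** * The graph metric and continuous maps on a compact space *)

Section Metric.
Context {X : Type} (rho : X -> X -> R) (Hmet : is_metric rho) (d : nat).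

Lemma metric_refl x : rho x x = 0.
Proof. apply Hmet. reflexivity. Qed.

Lemma metric_pos x y : x <> y -> 0 < rho x y.
Proof.
  destruct Hmet as [H1 [H2 _]]. intros h. destruct (H1 x y) as [h2|h2]; auto.
  exfalso. apply h, H2. auto.
Qed.

Lemma metric_pseudometric : pseudometric rho.
Proof. split; [apply metric_refl|]. apply Hmet. Qed.

Lemma graph_dist_hypot p q :
  graph_dist rho d p q = hypot (rho (fst p) (fst q)) (vnorm d (fun i => snd p i - snd q i)).
Proof. reflexivity. Qed.

Lemma graph_dist_pseudometric : pseudometric (graph_dist rho d).
Proof.
  destruct Hmet as [H0 [_ [Hs Ht]]]. split; [|split].
  - intros x. rewrite graph_dist_hypot, metric_refl, vnorm_zero by (intros; ring).
    unfold hypot. replace (0 ^ 2 + 0 ^ 2) with 0 by ring. apply sqrt_0.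
  - intros x y. rewrite !graph_dist_hypot, Hs, vnorm_dist_sym. reflexivity.
  - intros x y z. rewrite !graph_dist_hypot. eapply Rle_trans; [|apply hypot_triangle].
    apply hypot_monotone; auto.
    rewrite !Rabs_right by (apply Rle_ge; try apply vnorm_nonneg;
      apply Rplus_le_le_0_compat; apply vnorm_nonneg).
    apply vnorm_dist_triangle.
Qed.

Lemma rho_le_graph_dist p q : rho (fst p) (fst q) <= graph_dist rho d p q.
Proof. rewrite graph_dist_hypot. apply le_hypot_of_sqr. nra. Qed.

Lemma coord_le_graph_dist p q i : (i < d)%nat ->
  Rabs (snd p i - snd q i) <= graph_dist rho d p q.
Proof.
  intros hi. eapply Rle_trans; [apply (coord_le_vnorm d (fun i => snd p i - snd q i) i hi)|].
  rewrite graph_dist_hypot. apply le_hypot_of_sqr. nra.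
Qed.

Lemma graph_dist_le p q :
  graph_dist rho d p q <= rho (fst p) (fst q) + vnorm d (fun i => snd p i - snd q i).
Proof.
  rewrite graph_dist_hypot. eapply Rle_trans; [apply hypot_le_plus|].
  rewrite !Rabs_right; try lra; apply Rle_ge; [apply vnorm_nonneg|apply Hmet].
Qed.

Lemma inC_coord f : inC rho d f <->
  (forall x i, (d <= i)%nat -> f x i = 0) /\
  (forall x e, 0 < e -> exists delta, 0 < delta /\ forall y, rho x y < delta ->
    forall i, (i < d)%nat -> Rabs (f y i - f x i) < e).
Proof.
  split; intros [H1 H2]; split; auto; intros x e He.
  - destruct (H2 x e He) as [r [Hr H]]. exists r. split; auto.
    intros y Hy i Hi. eapply Rle_lt_trans; [|apply (H y Hy)].
    apply (coord_le_vnorm d (fun i => f y i - f x i) i Hi).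
  (* Dividing by [INR d + 1] instead of [INR d] covers [d = 0]. *)
  - assert (0 < INR d + 1) by (pose proof (pos_INR d); lra).
    destruct (H2 x (e / (INR d + 1))) as [r [Hr H']].
    { apply Rdiv_lt_0_compat; auto. }
    exists r. split; auto. intros y Hy.
    apply Rle_lt_trans with (INR d * (e / (INR d + 1))).
    + apply vnorm_le_coord; [apply Rlt_le, Rdiv_lt_0_compat; auto|].
      intros i Hi. left. apply H'; auto.
    + apply Rmult_lt_reg_r with (INR d + 1); auto. unfold Rdiv.
      rewrite Rmult_assoc, Rmult_assoc, Rinv_l; nra.
Qed.

Lemma inC_combination f g (s t : nat -> R) : inC rho d f -> inC rho d g ->
  inC rho d (fun x i => s i * f x i + t i * g x i).
Proof.
  rewrite !inC_coord. intros [F1 F2] [G1 G2]. split.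
  - intros x i hi. rewrite F1, G1; auto. ring.
  - intros x e he.
    assert (exists M, 0 < M /\ forall i, (i < d)%nat -> Rabs (s i) <= M /\ Rabs (t i) <= M) as [M [HM Hst]].
    { clear. induction d as [|k [M [H1 H2]]].
      - exists 1. split; [lra|]. intros i hi. lia.
      - exists (M + Rabs (s k) + Rabs (t k)).
        pose proof (Rabs_pos (s k)). pose proof (Rabs_pos (t k)). split; [lra|].
        intros i hi. destruct (Nat.eq_dec i k) as [->|hn]; [lra|].
        destruct (H2 i ltac:(lia)). lra. }
    assert (0 < e / (2 * M)) as He by (apply Rdiv_lt_0_compat; lra).
    destruct (F2 x _ He) as [r1 [Hr1 H1]]. destruct (G2 x _ He) as [r2 [Hr2 H2]].
    exists (Rmin r1 r2). split; [apply Rmin_pos; auto|].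
    intros y Hy i hi. pose proof (Rmin_l r1 r2). pose proof (Rmin_r r1 r2).
    specialize (H1 y ltac:(lra) i hi). specialize (H2 y ltac:(lra) i hi).
    replace (s i * f y i + t i * g y i - (s i * f x i + t i * g x i))
      with (s i * (f y i - f x i) + t i * (g y i - g x i)) by ring.
    eapply Rle_lt_trans; [apply Rabs_triang|]. rewrite !Rabs_mult.
    destruct (Hst i hi).
    assert (e = M * (e / (2 * M)) + M * (e / (2 * M))) by (field; lra).
    pose proof (Rabs_pos (f y i - f x i)). pose proof (Rabs_pos (g y i - g x i)).
    assert (Rabs (s i) * Rabs (f y i - f x i) <= M * Rabs (f y i - f x i)) by nra.
    assert (Rabs (t i) * Rabs (g y i - g x i) <= M * Rabs (g y i - g x i)) by nra.
    assert (M * Rabs (f y i - f x i) < M * (e / (2 * M))) by nra.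
    assert (M * Rabs (g y i - g x i) < M * (e / (2 * M))) by nra.
    lra.
Qed.

Lemma inC_scale g (t : nat -> R) : inC rho d g -> inC rho d (fun x i => t i * g x i).
Proof.
  intros H. replace (fun x i => t i * g x i) with (fun x i => t i * g x i + 0 * g x i).
  - apply (inC_combination g g t (fun _ => 0)); auto.
  - extensionality x. extensionality i. ring.
Qed.

Lemma inC_minus f h : inC rho d f -> inC rho d h -> inC rho d (fun x i => f x i - h x i).
Proof.
  intros Hf Hh. replace (fun x i => f x i - h x i) with (fun x i => 1 * f x i + (-1) * h x i).
  - apply (inC_combination f h (fun _ => 1) (fun _ => -1)); auto.
  - extensionality x. extensionality i. ring.
Qed.

Lemma inC_zero : inC rho d (fun _ _ => 0).
Proof.
  apply inC_coord. split; auto. intros x e He. exists 1. split; [lra|].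
  intros. rewrite Rminus_diag, Rabs_R0; auto.
Qed.

Hypothesis Hcpt : m_compact rho.

Lemma ball_open x r : m_open rho (fun y => rho x y < r).
Proof.
  intros y Hy. exists (r - rho x y). split; [lra|].
  intros z Hz. destruct Hmet as [_ [_ [_ Ht]]]. specialize (Ht x y z). lra.
Qed.

Lemma compact_net e : 0 < e -> exists l : list X, forall x, exists c, In c l /\ rho x c < e.
Proof.
  intros He. destruct (Hcpt X (fun x y => rho x y < e)) as [l Hl].
  - intros x. apply ball_open.
  - intros x. exists x. rewrite metric_refl; auto.
  - exists l. intros x. destruct (Hl x) as [c [h1 h2]]. exists c. split; auto.
    destruct Hmet as [_ [_ [Hs _]]]. rewrite Hs. auto.
Qed.

Lemma subset_totally_bounded S : totally_bounded rho S.
Proof.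
  intros e He. destruct (compact_net e He) as [l Hl]. exists l. auto.
Qed.

Lemma inC_bounded f : inC rho d f -> exists M, 0 < M /\ forall x i, Rabs (f x i) <= M.
Proof.
  rewrite inC_coord. intros [H0 H].
  (* The bound is imposed on a whole neighbourhood of [y], which makes each set of the cover open by
     the triangle inequality alone. *)
  destruct (Hcpt nat (fun k y => forall i, (i < d)%nat -> exists r, 0 < r /\ forall z, rho y z < r ->
     Rabs (f z i) < INR k)) as [l Hl].
  - intros k y Hy.
    destruct (list_uniform_radius (seq 0 d) (fun i r => forall z, rho y z < r -> Rabs (f z i) < INR k))
      as [r [Hr1 Hr2]].
    + intros i r r' _ h1 h2 z Hz. apply h1. lra.
    + intros i hi. apply in_seq in hi. apply Hy. lia.
    + exists (r / 2). split; [lra|]. intros z Hz i Hi. exists (r / 2). split; [lra|].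
      intros w Hw. apply Hr2; [apply in_seq; lia|].
      destruct Hmet as [_ [_ [_ Ht]]]. specialize (Ht y z w). lra.
  - intros x. destruct (H x 1 Rlt_0_1) as [r [Hr Hx]].
    assert (exists M, forall i, (i < d)%nat -> Rabs (f x i) <= M) as [M HM].
    { exists (vnorm d (f x)). intros i hi. apply (coord_le_vnorm d (f x) i hi). }
    destruct (INR_unbounded (M + 1)) as [k Hk].
    exists k. intros i hi. exists r. split; auto. intros z Hz.
    specialize (Hx z Hz i hi). specialize (HM i hi).
    pose proof (Rabs_triang (f z i - f x i) (f x i)).
    replace (f z i - f x i + f x i) with (f z i) in * by ring. lra.
  - destruct (list_uniform_nat l (fun k n => (k <= n)%nat)) as [n Hn].
    + intros; lia.
    + intros k _. exists k; auto.
    + exists (INR n + 1). pose proof (pos_INR n). split; [lra|]. intros x i.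
      destruct (Nat.lt_ge_cases i d) as [hi|hi].
      * destruct (Hl x) as [k [Hk1 Hk2]]. destruct (Hk2 i hi) as [r [Hr Hz]].
        specialize (Hz x ltac:(rewrite metric_refl; auto)).
        specialize (le_INR _ _ (Hn k Hk1)). lra.
      * rewrite H0, Rabs_R0; auto. lra.
Qed.

(** If a Cauchy sequence has no limit, every point has a ball that the sequence finally avoids.
    Finitely many such balls cover the space, and a late term would lie in none of them. *)
Lemma compact_complete (u : nat -> X) :
  (forall e, 0 < e -> exists N, forall m n, (N <= m)%nat -> (N <= n)%nat -> rho (u m) (u n) < e) ->
  exists y, forall e, 0 < e -> exists N, forall n, (N <= n)%nat -> rho (u n) y < e.
Proof.
  intros Hu. apply NNPP. intros Hn.
  assert (Ht : forall x y z, rho x z <= rho x y + rho y z) by apply Hmet.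
  assert (Hs : forall x y, rho x y = rho y x) by apply Hmet.
  assert (forall x, exists r N, 0 < r /\ forall n, (N <= n)%nat -> r <= rho x (u n)) as Hfar.
  { intros x. apply NNPP. intros Hx. apply Hn. exists x. intros e He.
    destruct (Hu (e / 2) ltac:(lra)) as [N HN]. exists N. intros n hn.
    assert (exists m, (N <= m)%nat /\ rho x (u m) < e / 2) as [m [hm1 hm2]].
    { apply NNPP. intros hc. apply Hx. exists (e / 2), N. split; [lra|].
      intros m hm. apply Rnot_lt_le. intros h. apply hc; eauto. }
    specialize (HN n m hn hm1). specialize (Ht (u n) (u m) x). rewrite (Hs (u m)) in Ht. lra. }
  destruct (choice (fun x (p : R * nat) => 0 < fst p /\ forall n, (snd p <= n)%nat -> fst p <= rho x (u n)))
    as [p Hp].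
  { intros x. destruct (Hfar x) as [r [N h]]. exists (r, N). auto. }
  destruct (Hcpt X (fun x y => rho x y < fst (p x))) as [l Hl].
  - intros x. apply ball_open.
  - intros x. exists x. rewrite metric_refl. apply Hp.
  - destruct (list_uniform_nat l (fun x n => (snd (p x) <= n)%nat)) as [n Hn'].
    + intros; lia.
    + intros x _. eauto.
    + destruct (Hl (u n)) as [x [h1 h2]]. destruct (Hp x) as [_ h3].
      specialize (h3 n (Hn' x h1)). lra.
Qed.

(** * The space of continuous maps *)

Hypothesis x0 : X.

(** Compactness keeps the supremum from being [p_infty] and [x0] keeps it from being [m_infty], so
    [real_of_Rbar] does not fall back on its default value 0. *)
Lemma cdist_lub f g : inC rho d f -> inC rho d g ->
  (forall x, vnorm d (fun i => f x i - g x i) <= cdist d f g) /\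
  (forall c, (forall x, vnorm d (fun i => f x i - g x i) <= c) -> cdist d f g <= c).
Proof.
  intros Hf Hg. destruct (inC_bounded _ (inC_minus f g Hf Hg)) as [M [HM Hb]].
  unfold cdist.
  destruct (Rbar_sup_lub (fun v => exists x, v = Finite (vnorm d (fun i => f x i - g x i)))) as [H1 H2].
  set (s := Rbar_sup _) in *.
  assert (Rbar_le s (Finite (INR d * M))) as HsM.
  { apply H2. intros v [x ->]. simpl. apply vnorm_le_coord; [lra|]. auto. }
  pose proof (H1 _ (ex_intro _ x0 eq_refl)) as Hx0.
  destruct s as [r| |]; simpl in HsM, Hx0; try tauto. simpl. split.
  - intros x. exact (H1 _ (ex_intro _ x eq_refl)).
  - intros c Hc. apply (H2 (Finite c)). intros v [x ->]. simpl. auto.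
Qed.

Lemma cdist_coord f g x i : inC rho d f -> inC rho d g -> (i < d)%nat ->
  Rabs (f x i - g x i) <= cdist d f g.
Proof.
  intros Hf Hg hi. eapply Rle_trans; [|apply (proj1 (cdist_lub f g Hf Hg) x)].
  apply (coord_le_vnorm d (fun i => f x i - g x i) i hi).
Qed.

Lemma cdist_le_coord f g c : inC rho d f -> inC rho d g -> 0 <= c ->
  (forall x i, (i < d)%nat -> Rabs (f x i - g x i) <= c) -> cdist d f g <= INR d * c.
Proof.
  intros Hf Hg hc H. apply (proj2 (cdist_lub f g Hf Hg)).
  intros x. apply vnorm_le_coord; auto.
Qed.

Lemma cdist_refl f : inC rho d f -> cdist d f f = 0.
Proof.
  intros Hf. apply Rle_antisym.
  - apply (cdist_lub f f Hf Hf). intros x. rewrite vnorm_zero; [lra|]. intros; ring.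
  - eapply Rle_trans; [|apply (proj1 (cdist_lub f f Hf Hf) x0)]. apply vnorm_nonneg.
Qed.

Lemma cdist_sym (f g : X -> nat -> R) : cdist d f g = cdist d g f.
Proof.
  unfold cdist. do 2 f_equal. extensionality v. apply propositional_extensionality.
  split; intros [x ->]; exists x; rewrite vnorm_dist_sym; auto.
Qed.

Lemma cdist_triangle f g h : inC rho d f -> inC rho d g -> inC rho d h ->
  cdist d f h <= cdist d f g + cdist d g h.
Proof.
  intros Hf Hg Hh. apply (cdist_lub f h Hf Hh). intros x.
  eapply Rle_trans; [apply vnorm_dist_triangle with (b := g x)|].
  apply Rplus_le_compat; apply cdist_lub; auto.
Qed.

Lemma inC_complete (u : nat -> X -> nat -> R) : (forall n, inC rho d (u n)) ->
  (forall e, 0 < e -> exists N, forall m n, (N <= m)%nat -> (N <= n)%nat -> cdist d (u m) (u n) < e) ->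
  exists f, inC rho d f /\
    forall e, 0 < e -> exists N, forall n, (N <= n)%nat -> cdist d (u n) f < e.
Proof.
  intros Hu Hc.
  assert (Hlim : forall x i, exists l, Un_cv (fun n => u n x i) l).
  { intros x i. destruct (Nat.lt_ge_cases i d) as [hi|hi].
    - destruct (R_complete (fun n => u n x i)) as [l Hl]; eauto.
      intros e He. destruct (Hc e He) as [N HN]. exists N. intros n m hn hm.
      eapply Rle_lt_trans; [|apply (HN n m hn hm)]. apply cdist_coord; auto.
    - exists 0. intros e He. exists 0%nat. intros n _. rewrite (proj1 (Hu n)); auto.
      unfold Rdist. rewrite Rminus_diag, Rabs_R0. auto. }
  destruct (choice (fun x (l : nat -> R) => forall i, Un_cv (fun n => u n x i) (l i))) as [f Hf].
  { intros x. apply (choice (fun i l => Un_cv (fun n => u n x i) l)). auto. }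
  assert (Hclose : forall e, 0 < e -> exists N, forall n x i, (N <= n)%nat -> (i < d)%nat ->
    Rabs (u n x i - f x i) <= e).
  { intros e He. destruct (Hc (e / 2) ltac:(lra)) as [N HN]. exists N. intros n x i hn hi.
    destruct (Hf x i (e / 2) ltac:(lra)) as [N' HN'].
    specialize (HN' (max N N') ltac:(lia)). specialize (HN n (max N N') hn ltac:(lia)).
    pose proof (cdist_coord (u n) (u (max N N')) x i (Hu n) (Hu _) hi).
    unfold Rdist in HN'.
    pose proof (Rabs_triang (u n x i - u (max N N') x i) (u (max N N') x i - f x i)).
    replace (u n x i - u (max N N') x i + (u (max N N') x i - f x i)) with (u n x i - f x i) in * by ring.
    lra. }
  assert (inC rho d f) as Hfc.
  { apply inC_coord. split.
    - intros x i hi. apply (UL_sequence (fun n => u n x i)); auto.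
      intros e He. exists 0%nat. intros n _. rewrite (proj1 (Hu n)); auto.
      unfold Rdist. rewrite Rminus_diag, Rabs_R0. auto.
    - intros x e He. destruct (Hclose (e / 4) ltac:(lra)) as [N HN].
      destruct (proj2 (proj1 (inC_coord (u N)) (Hu N)) x (e / 4) ltac:(lra)) as [r [Hr H]].
      exists r. split; auto. intros y Hy i hi.
      specialize (H y Hy i hi). pose proof (HN N x i (le_n N) hi) as hx.
      pose proof (HN N y i (le_n N) hi) as hy.
      rewrite Rabs_minus_sym in hy.
      pose proof (Rabs_triang (f y i - u N y i) (u N y i - f x i)).
      pose proof (Rabs_triang (u N y i - u N x i) (u N x i - f x i)).
      replace (f y i - u N y i + (u N y i - f x i)) with (f y i - f x i) in * by ring.
      replace (u N y i - u N x i + (u N x i - f x i)) with (u N y i - f x i) in * by ring.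
      lra. }
  exists f. split; auto. intros e He.
  assert (0 < INR d + 1) by (pose proof (pos_INR d); lra).
  destruct (Hclose (e / (INR d + 1))) as [N HN].
  { apply Rdiv_lt_0_compat; lra. }
  exists N. intros n hn.
  apply Rle_lt_trans with (INR d * (e / (INR d + 1))).
  - apply cdist_le_coord; auto. apply Rlt_le, Rdiv_lt_0_compat; lra.
  - apply Rmult_lt_reg_r with (INR d + 1); auto. unfold Rdiv.
    rewrite Rmult_assoc, Rmult_assoc, Rinv_l; nra.
Qed.

End Metric.

(** * Baire category *)

(** Stated relative to a subset [P] because of its two uses: the maps with [inC] among all
    functions, and a closed kernel inside [K]. *)
Lemma baire {Y : Type} (dist : Y -> Y -> R) (P : Y -> Prop) (O : nat -> Y -> Prop) (y0 : Y) :
  (forall x, P x -> dist x x = 0) ->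
  (forall x y, dist x y = dist y x) ->
  (forall x y z, P x -> P y -> P z -> dist x z <= dist x y + dist y z) ->
  (forall u : nat -> Y, (forall n, P (u n)) ->
    (forall e, 0 < e -> exists N, forall m n, (N <= m)%nat -> (N <= n)%nat -> dist (u m) (u n) < e) ->
    exists y, P y /\ forall e, 0 < e -> exists N, forall n, (N <= n)%nat -> dist (u n) y < e) ->
  (forall k y, P y -> O k y -> exists e, 0 < e /\ forall z, P z -> dist y z < e -> O k z) ->
  (forall k y e, P y -> 0 < e -> exists z, P z /\ dist y z < e /\ O k z) ->
  P y0 -> exists y, P y /\ forall k, O k y.
Proof.
  intros H0 Hs Ht Hcomp Hopen Hdense HP0.
  set (good := fun p : Y * R => P (fst p) /\ 0 < snd p).
  (* Halving the radii nests the balls. The limit is only known to be within twice the radius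
     [snd q] of the centre, one radius for the later centres and one for the convergence; hence the
     factor 2. *)
  set (next := fun k (p q : Y * R) => good q /\ dist (fst p) (fst q) < snd p / 2 /\
    snd q <= snd p / 2 /\ snd q <= (/2) ^ k /\
    forall z, P z -> dist (fst q) z < 2 * snd q -> O k z).
  assert (Hstep : forall k p, good p -> exists q, next k p q).
  { intros k [y e] [Hy He]; simpl in *.
    destruct (Hdense k y (e / 2) Hy ltac:(lra)) as [z [Hz1 [Hz2 Hz3]]].
    destruct (Hopen k z Hz1 Hz3) as [r [Hr1 Hr2]].
    pose proof (pow_half_pos k).
    exists (z, Rmin (r / 2) (Rmin (e / 2) ((/2) ^ k))).
    pose proof (Rmin_l (r / 2) (Rmin (e / 2) ((/2) ^ k))).
    pose proof (Rmin_r (r / 2) (Rmin (e / 2) ((/2) ^ k))).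
    pose proof (Rmin_l (e / 2) ((/2) ^ k)). pose proof (Rmin_r (e / 2) ((/2) ^ k)).
    split; [split; simpl; auto; repeat apply Rmin_pos; lra|].
    simpl. repeat split; auto; try lra. intros w Hw1 Hw2. apply Hr2; auto. lra. }
  destruct (choice (fun (kp : nat * (Y * R)) q => good (snd kp) -> next (fst kp) (snd kp) q))
    as [F HF].
  { intros [k p]. destruct (classic (good p)) as [h|h].
    - destruct (Hstep k p h) as [q Hq]. exists q; auto.
    - exists p. tauto. }
  set (s := fix s n := match n with O => (y0, 1) | S k => F (k, s k) end).
  assert (Hgood : forall n, good (s n)).
  { induction n as [|n IH]; [split; simpl; auto; lra|]. apply (HF (n, s n) IH). }
  assert (Hnext : forall n, next n (s n) (s (S n))).
  { intros n. apply (HF (n, s n)), Hgood. }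
  assert (Hnest : forall k n, dist (fst (s n)) (fst (s (n + k)%nat)) < snd (s n)).
  { induction k as [|k IH]; intros n.
    - rewrite Nat.add_0_r, H0; apply Hgood.
    - destruct (Hnext n) as [_ [h1 [h2 _]]]. specialize (IH (S n)).
      replace (n + S k)%nat with (S n + k)%nat by lia.
      pose proof (Ht (fst (s n)) (fst (s (S n))) (fst (s (S n + k)%nat))
        (proj1 (Hgood _)) (proj1 (Hgood _)) (proj1 (Hgood _))). lra. }
  destruct (Hcomp (fun n => fst (s n))) as [y [Hy Hlim]].
  - intros n. apply Hgood.
  - intros e He. destruct (pow_half_small (e / 2) ltac:(lra)) as [N HN].
    exists (S N). intros m n hm hn.
    assert (snd (s (S N)) < e / 2).
    { destruct (Hnext N) as [_ [_ [_ [h _]]]]. lra. }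
    pose proof (Hnest (m - S N)%nat (S N)) as h1. pose proof (Hnest (n - S N)%nat (S N)) as h2.
    replace (S N + (m - S N))%nat with m in h1 by lia.
    replace (S N + (n - S N))%nat with n in h2 by lia.
    pose proof (Ht (fst (s m)) (fst (s (S N))) (fst (s n))
        (proj1 (Hgood _)) (proj1 (Hgood _)) (proj1 (Hgood _))) as h3.
    rewrite (Hs (fst (s m)) (fst (s (S N)))) in h3. lra.
  - exists y. split; auto. intros k.
    destruct (Hnext k) as [[hP hr] [_ [_ [_ h]]]]. apply h; auto.
    destruct (Hlim (snd (s (S k))) hr) as [N HN].
    pose proof (HN (S k + N)%nat ltac:(lia)) as h1. pose proof (Hnest N (S k)) as h2.
    pose proof (Ht (fst (s (S k))) (fst (s (S k + N)%nat)) y hP (proj1 (Hgood _)) Hy). lra.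
Qed.

(** * Grids *)

(** Coordinates from [d] on are 0, so a label is determined, as a function, by its first [d]
    values. *)
Fixpoint grid (d L : nat) : list (nat -> nat) :=
  match d with
  | O => (fun _ => O) :: nil
  | S k => map (fun p i => if Nat.eqb i k then snd p else fst p i)
      (list_prod (grid k L) (seq 0 L))
  end.

Lemma grid_spec d L m : In m (grid d L) <->
  (forall i, (i < d)%nat -> (m i < L)%nat) /\ (forall i, (d <= i)%nat -> m i = O).
Proof.
  revert m. induction d as [|k IH]; intros m; simpl.
  - split.
    + intros [<-|[]]. split; intros; lia.
    + intros [_ H]. left. extensionality i. rewrite H; lia.
  - rewrite in_map_iff. split.
    + intros [[m' a] [<- H]]. apply in_prod_iff in H as [H1 H2].
      apply IH in H1 as [H3 H4]. apply in_seq in H2. simpl. split; intros i hi;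
        destruct (Nat.eqb_spec i k); try lia; [apply H3|apply H4]; lia.
    + intros [H1 H2]. exists (fun i => if Nat.eqb i k then O else m i, m k). split.
      * extensionality i. simpl. destruct (Nat.eqb_spec i k); subst; auto.
      * apply in_prod_iff. split.
        -- apply IH. split; intros i hi; destruct (Nat.eqb_spec i k); try lia; [apply H1|apply H2]; lia.
        -- apply in_seq. specialize (H1 k). lia.
Qed.

Lemma grid_length d L : length (grid d L) = (L ^ d)%nat.
Proof.
  induction d as [|k IH]; simpl; auto.
  rewrite length_map, length_prod, length_seq, IH. lia.
Qed.

Lemma grid_step_injective k L : forall p q, In p (list_prod (grid k L) (seq 0 L)) ->
  In q (list_prod (grid k L) (seq 0 L)) ->
  (fun i => if Nat.eqb i k then snd p else fst p i) =
  (fun i => if Nat.eqb i k then snd q else fst q i) -> p = q.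
Proof.
  intros [m a] [m' a'] Hp Hq H. apply in_prod_iff in Hp as [Hp _], Hq as [Hq _].
  apply grid_spec in Hp as [_ Hp], Hq as [_ Hq]. simpl in H.
  assert (forall i, (if Nat.eqb i k then a else m i) = (if Nat.eqb i k then a' else m' i)) as H'.
  { intros i. apply (f_equal (fun h => h i) H). }
  f_equal.
  - extensionality i. specialize (H' i). destruct (Nat.eqb_spec i k); auto. subst.
    rewrite Hp, Hq; auto.
  - specialize (H' k). rewrite Nat.eqb_refl in H'. auto.
Qed.

Lemma grid_NoDup d L : NoDup (grid d L).
Proof.
  induction d as [|k IH]; simpl.
  - constructor; [simpl; tauto|constructor].
  - apply NoDup_map_NoDup_ForallPairs; [exact (grid_step_injective k L)|].
    apply NoDup_list_prod; auto. apply seq_NoDup.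
Qed.

Lemma nat_floor x : 0 <= x -> exists k : nat, INR k <= x < INR k + 1.
Proof.
  intros Hx. destruct (archimed x) as [H1 H2].
  assert (0 < up x)%Z by (apply lt_IZR; lra).
  exists (Z.to_nat (up x - 1)). rewrite INR_IZR_INZ, Z2Nat.id, minus_IZR by lia. lra.
Qed.

Lemma Rpower2_INR k : Rpower 2 (INR k) = 2 ^ k.
Proof. apply Rpower_pow. lra. Qed.

Section Dimension.
Context {X : Type} (rho : X -> X -> R) (Hmet : is_metric rho) (Hcpt : m_compact rho).
Context (d : nat).

Let rho_pseudo : pseudometric rho := metric_pseudometric rho Hmet.
Let gd_pseudo : pseudometric (graph_dist rho d) := graph_dist_pseudometric rho Hmet d.

(** * Dimension of the graph from above *)

Definition graph_on (f : X -> nat -> R) (A : X -> Prop) : X * (nat -> R) -> Prop :=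
  fun p => exists x, A x /\ p = (x, f x).

(** Sorts the points by a nearby centre in [E] and by the cell of the value in a subdivision of a
    cube containing the range. Only the boundedness of [f] enters: all cells of the cube are counted
    over each centre. *)
Lemma graph_separated_count f : inC rho d f -> exists C0 : nat, forall (A : X -> Prop) n E l,
  (forall x, A x -> exists z, In z E /\ rho x z <= (/2) ^ (n + 2)) ->
  separated_list (graph_dist rho d) (graph_on f A) n l ->
  (length l <= length E * (C0 * 2 ^ n) ^ d)%nat.
Proof.
  intros Hf. destruct (inC_bounded rho Hmet d Hcpt f Hf) as [M [HM Hb]].
  destruct (INR_unbounded (2 * M * (INR d + 1) * 2)) as [C0 HC0].
  exists C0. intros A n E l HE [Hl1 [Hl2 Hl3]].
  pose proof (pos_INR d). assert (0 < 2 ^ n) by (apply pow_lt; lra).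
  (* Cells have side [/ Q], so two values in one cell are within half of 2^(-n). The detour through
     the common centre in [E] costs twice a quarter of 2^(-n), the other half. *)
  set (Q := (INR d + 1) * (2 * 2 ^ n)). assert (0 < Q) by (unfold Q; nra).
  assert (Hcell : forall x i, exists k, INR k <= (f x i + M) * Q < INR k + 1).
  { intros x i. apply nat_floor. specialize (Hb x i). apply Rabs_le_inv in Hb. nra. }
  destruct (choice (fun x (c : nat -> nat) => forall i, INR (c i) <= (f x i + M) * Q < INR (c i) + 1))
    as [cell Hc].
  { intros x. apply (choice (fun i k => INR k <= (f x i + M) * Q < INR k + 1)). auto. }
  destruct (choice (fun x z => A x -> In z E /\ rho x z <= (/2) ^ (n + 2))) as [ctr Hctr].
  { intros x. destruct (classic (A x)) as [h|h].
    - destruct (HE x h) as [z Hz]. exists z; auto.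
    - exists x; tauto. }
  rewrite <- (grid_length d), <- length_prod.
  apply (length_le_of_injection (fun p : X * (nat -> R) =>
    (ctr (fst p), fun i => if Nat.ltb i d then cell (fst p) i else O))); auto.
  - intros p Hp. destruct (Hl2 p Hp) as [x [Hx ->]]. simpl.
    apply in_prod_iff. split; [apply Hctr; auto|]. apply grid_spec.
    split; intros i hi; destruct (Nat.ltb_spec i d); try lia.
    destruct (Hc x i) as [h _]. specialize (Hb x i). apply Rabs_le_inv in Hb.
    apply INR_lt. rewrite mult_INR, pow_INR. change (INR 2) with 2.
    assert ((f x i + M) * Q <= 2 * M * Q) by nra.
    assert (2 * M * Q < INR C0 * 2 ^ n); [|lra].
    unfold Q. replace (2 * M * ((INR d + 1) * (2 * 2 ^ n))) with (2 * M * (INR d + 1) * 2 * 2 ^ n) by ring.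
    nra.
  - intros p q Hp Hq Heq. apply NNPP. intros hn.
    pose proof (Hl3 p q Hp Hq hn) as Hfar.
    destruct (Hl2 p Hp) as [x [Hx ->]]. destruct (Hl2 q Hq) as [y [Hy ->]].
    simpl in Heq. injection Heq as E1 E2.
    pose proof (graph_dist_le rho Hmet d (x, f x) (y, f y)) as Hle. simpl in Hle.
    destruct (Hctr x Hx) as [_ h1]. destruct (Hctr y Hy) as [_ h2]. rewrite <- E1 in h2.
    pose proof Hmet as [_ [_ [Hs Ht]]]. pose proof (Ht x (ctr x) y) as Htri. rewrite (Hs (ctr x) y) in Htri.
    assert (vnorm d (fun i => f x i - f y i) <= INR d * / Q).
    { apply vnorm_le_coord; [apply Rlt_le, Rinv_0_lt_compat; auto|].
      intros i hi. apply (f_equal (fun h => h i)) in E2.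
      destruct (Nat.ltb_spec i d); try lia.
      destruct (Hc x i) as [a1 a2], (Hc y i) as [b1 b2]. rewrite E2 in *.
      apply Rmult_le_reg_r with Q; auto. rewrite Rinv_l by lra.
      rewrite <- (Rabs_right Q) at 1 by lra. rewrite <- Rabs_mult. apply Rabs_le. lra. }
    assert (INR d * / Q <= (/2) ^ n / 2).
    { unfold Q. rewrite pow_inv. rewrite !Rinv_mult.
      assert (INR d * / (INR d + 1) <= 1).
      { apply Rmult_le_reg_r with (INR d + 1); [lra|]. rewrite Rmult_assoc, Rinv_l; lra. }
      assert (0 < / 2 ^ n) by (apply Rinv_0_lt_compat; auto). nra. }
    rewrite pow_add in h1, h2. simpl pow in h1 at 2, h2 at 2. lra.
Qed.

Lemma upper_box_dim_graph_le f A v : inC rho d f ->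
  Rbar_le (upper_box_dim rho A) (Finite v) ->
  Rbar_le (upper_box_dim (graph_dist rho d) (graph_on f A)) (Finite (v + INR d)).
Proof.
  intros Hf HA. pose proof (upper_box_dim_nonneg rho rho_pseudo A v HA) as Hv.
  apply (upper_box_dim_le_iff rho rho_pseudo) in HA as [[a Ha] [Htb HA]].
  destruct (graph_separated_count f Hf) as [C0 HC0].
  assert (Hnet : forall n, exists E, separated_list rho A (n + 2) E /\
     forall x, A x -> exists z, In z E /\ rho x z <= (/2) ^ (n + 2)).
  { intros n. destruct (separated_bounded rho rho_pseudo A Htb (n + 2)) as [M HM].
    destruct (maximal_separated rho rho_pseudo A (n + 2) M HM) as [E [H1 [_ H2]]]. eauto. }
  apply (upper_box_dim_le_iff _ gd_pseudo). split; [|split].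
  - exists (a, f a), a. auto.
  - apply (totally_bounded_of_separated _ gd_pseudo). intros n.
    destruct (Hnet n) as [E [_ HE]]. eauto.
  - intros e He. destruct (HA (e / 2) ltac:(lra)) as [N HN].
    set (k := (C0 ^ d)%nat).
    (* The shift by two scales and the constant factor [k <= 2 ^ k] add [2 * (v + e / 2) + INR k] to
       the exponent; from [N'] on this is at most [INR n * (e / 2)]. *)
    destruct (INR_unbounded ((2 * (v + e / 2) + INR k) / (e / 2))) as [N' HN'].
    exists (N + N')%nat. intros n l Hn Hl.
    destruct (Hnet n) as [E [HE1 HE2]].
    pose proof (HC0 A n E l HE2 Hl) as Hlen. apply le_INR in Hlen.
    eapply Rle_trans; [exact Hlen|].
    rewrite Nat.pow_mul_l, !mult_INR. fold k.
    specialize (HN (n + 2)%nat E ltac:(lia) HE1).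
    assert (INR k <= Rpower 2 (INR k)) as Hk.
    { rewrite Rpower2_INR. change 2 with (INR 2). rewrite <- pow_INR.
      apply le_INR, Nat.lt_le_incl, Nat.pow_gt_lin_r. lia. }
    assert (INR ((2 ^ n) ^ d) = Rpower 2 (INR n * INR d)) as ->.
    { rewrite <- mult_INR, Rpower2_INR, <- Nat.pow_mul_r, pow_INR. reflexivity. }
    apply Rle_trans with (Rpower 2 (INR (n + 2) * (v + e / 2)) * (Rpower 2 (INR k) * Rpower 2 (INR n * INR d))).
    { assert (0 < Rpower 2 (INR n * INR d)) by apply exp_pos.
      apply Rmult_le_compat; auto using pos_INR.
      - apply Rmult_le_pos; [apply pos_INR|lra].
      - apply Rmult_le_compat_r; lra. }
    rewrite <- !Rpower_plus. apply Rpower2_le. rewrite plus_INR. change (INR 2) with 2.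
    apply le_INR in Hn. rewrite plus_INR in Hn. pose proof (pos_INR N).
    assert (2 * (v + e / 2) + INR k <= INR n * (e / 2)); [|lra].
    replace (2 * (v + e / 2) + INR k) with ((2 * (v + e / 2) + INR k) / (e / 2) * (e / 2)) by (field; lra).
    apply Rmult_le_compat_r; lra.
Qed.

Lemma packing_dim_graph_le f : inC rho d f ->
  Rbar_le (packing_dim (graph_dist rho d) (graph f))
    (Rbar_plus (packing_dim rho (fun _ => True)) (Finite (INR d))).
Proof.
  intros Hf.
  (* [packing_dim_ge] needs the dimension of [K] alone on the right, so [INR d] is moved across and
     back again at the end. *)
  assert (H : Rbar_le (Rbar_plus (packing_dim (graph_dist rho d) (graph f)) (Finite (- INR d)))
    (packing_dim rho (fun _ => True))).
  { apply packing_dim_ge. intros A v HA Hv.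
    assert (Rbar_le (packing_dim (graph_dist rho d) (graph f)) (Finite (v + INR d))) as h.
    { apply (packing_dim_le _ _ (fun i => graph_on f (A i))).
      - intros p [x ->]. destruct (HA x I) as [i Hi]. exists i, x. auto.
      - intros i. apply upper_box_dim_graph_le; auto. }
    destruct (packing_dim _ _); simpl in *; auto. lra. }
  destruct (packing_dim (graph_dist rho d) _), (packing_dim rho _); simpl in *; auto. lra.
Qed.

(** * The kernel of positive dimension *)

(* Points are small also for [s < 0], where no set has dimension at most [s]: small then
   means countable, which is how the uncountability of [K] enters when [dim_P K = 0]. *)
Definition small (s : R) (A : X -> Prop) : Prop :=
  exists E : nat -> X -> Prop, (forall x, A x -> exists i, E i x) /\
    forall i, (forall x y, E i x -> E i y -> x = y) \/
      Rbar_le (upper_box_dim rho (E i)) (Finite s).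

Lemma small_incl s (A B : X -> Prop) : (forall x, A x -> B x) -> small s B -> small s A.
Proof. intros H [E [H1 H2]]. exists E. auto. Qed.

Lemma small_union s (A : nat -> X -> Prop) :
  (forall n, small s (A n)) -> small s (fun x => exists n, A n x).
Proof.
  intros H. apply choice in H as [E HE].
  exists (fun k => E (fst (of_nat k)) (snd (of_nat k))). split.
  - intros x [n Hn]. destruct (HE n) as [H1 _]. destruct (H1 x Hn) as [i Hi].
    exists (to_nat (n, i)). rewrite cancel_of_to. auto.
  - intros k. apply HE.
Qed.

Lemma small_list s (l : list X) : small s (fun x => In x l).
Proof.
  exists (fun i x => nth_error l i = Some x). split.
  - intros x Hx. apply In_nth_error. auto.
  - intros i. left. congruence.
Qed.

Lemma whole_space_not_small (x0 : X) s : uncountable X ->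
  ~ Rbar_le (packing_dim rho (fun _ => True)) (Finite s) -> ~ small s (fun _ => True).
Proof.
  intros Hunc Hs [E [HE1 HE2]]. destruct (Rle_lt_dec 0 s) as [h|h].
  - apply Hs.
    (* An empty piece has dimension [p_infty] by convention and is replaced by the singleton of
       [x0]. *)
    apply (packing_dim_le _ _ (fun i x => E i x \/ (~ (exists y, E i y) /\ x = x0))).
    + intros x _. destruct (HE1 x I) as [i Hi]. exists i. auto.
    + intros i. destruct (classic (exists y, E i y)) as [[y Hy]|Hn].
      * destruct (HE2 i) as [Hi|Hi].
        -- apply (upper_box_dim_singleton rho rho_pseudo _ y); auto.
           intros x [Hx|[Hx _]]; [auto|exfalso; eauto].
        -- replace (fun x => _) with (E i); auto.
           extensionality x. apply propositional_extensionality.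
           split; auto. intros [Hx|[Hx _]]; [auto|exfalso; eauto].
      * apply (upper_box_dim_singleton rho rho_pseudo _ x0); auto.
        intros x [Hx|[_ Hx]]; [exfalso; eauto|auto].
  (* For [s < 0] no piece has dimension at most [s], so each has at most one point and the choice of
     a piece injects [X] into [nat]. *)
  - apply Hunc. destruct (choice (fun x i => E i x)) as [g Hg].
    { intros x. apply HE1. exact I. }
    exists g. intros x y e. destruct (HE2 (g x)) as [Hi|Hi].
    + apply Hi; auto. rewrite e. auto.
    + apply (upper_box_dim_nonneg rho rho_pseudo) in Hi. lra.
Qed.

(** The first condition supplies the cluster centres at infinitely many scales, the second the
    points of [S] near each centre that will carry the grid labels. *)
Definition rich (s : R) (S : X -> Prop) : Prop :=
  (forall N, exists n l, (N <= n)%nat /\ separated_list rho S n l /\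
    Rpower 2 (INR n * s) <= INR (length l)) /\
  (forall x r T, S x -> 0 < r -> exists l, NoDup l /\ length l = T /\
    forall y, In y l -> S y /\ rho x y < r).

Definition countable_base (V : nat -> X -> Prop) : Prop :=
  (forall k, m_open rho (V k)) /\
  forall x r, 0 < r -> exists k, V k x /\ forall y, V k y -> rho x y < r.

Lemma countable_base_exists : exists V, countable_base V.
Proof.
  destruct (choice (fun m l => forall x, exists c, In c l /\ rho x c < (/2) ^ m)) as [net Hnet].
  { intros m. apply (compact_net rho Hmet Hcpt). apply pow_half_pos. }
  (* The index codes a radius and a position in the corresponding net; positions beyond its end give
     the empty set. *)
  exists (fun k y => exists c, nth_error (net (fst (of_nat k))) (snd (of_nat k)) = Some c /\
    rho c y < (/2) ^ (fst (of_nat k))).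
  pose proof Hmet as [_ [_ [Hs Ht]]]. split.
  - intros k y [c [Hc Hy]].
    destruct (ball_open rho Hmet c _ y Hy) as [e [He H]]. exists e. split; auto.
    intros z Hz. exists c. split; auto.
  - intros x r Hr. destruct (pow_half_small (r / 2) ltac:(lra)) as [m Hm].
    destruct (Hnet m x) as [c [Hc1 Hc2]]. apply In_nth_error in Hc1 as [i Hi].
    exists (to_nat (m, i)). rewrite cancel_of_to. simpl. split.
    + exists c. rewrite Hs. auto.
    + intros y [c' [E Hy]]. rewrite Hi in E. injection E as <-.
      specialize (Ht x c y). lra.
Qed.

(** A Cantor-Bendixson argument. The removed set is itself small, so a base set meeting [C] has a
    trace on [C] that is not small, otherwise it would have been removed. A trace of dimension at
    most [s], or one that is finite near one of its points, would contradict this. *)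
Lemma kernel_exists V s : countable_base V -> ~ small s (fun _ => True) ->
  exists C : X -> Prop, nonempty_set C /\ m_open rho (fun x => ~ C x) /\
    forall k, nonempty_set (fun x => V k x /\ C x) -> rich s (fun x => V k x /\ C x).
Proof.
  intros [HV1 HV2] Hbig.
  set (C := fun x => forall k, V k x -> ~ small s (V k)).
  assert (Hout : small s (fun x => ~ C x)).
  { apply small_incl with (fun x => exists k, V k x /\ small s (V k)).
    { intros x Hx. apply NNPP. intros Hn. apply Hx. intros k Hk Hsm. apply Hn. eauto. }
    apply small_union. intros k. destruct (classic (small s (V k))) as [h|h].
      + apply small_incl with (V k); tauto.
      + apply small_incl with (fun x => In x nil); [tauto|apply small_list]. }
  assert (Htwo : forall A B : X -> Prop, small s A -> small s B -> small s (fun x => A x \/ B x)).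
  { intros A B HA HB. apply small_incl with (fun x => exists n : nat, match n with O => A x | _ => B x end).
    - intros x [h|h]; [exists 0%nat|exists 1%nat]; auto.
    - apply small_union. intros [|n]; auto. }
  assert (Hin : forall k x, V k x -> C x -> ~ small s (fun x => V k x /\ C x)).
  { intros k x Hk Hx Hsm. apply (Hx k Hk).
    eapply small_incl; [|exact (Htwo _ _ Hsm Hout)]. intros y Hy. simpl. tauto. }
  exists C. split; [|split].
  - apply NNPP. intros Hn. apply Hbig. eapply small_incl; [|exact Hout].
    intros x _ Hx. apply Hn. exists x. auto.
  - intros x Hx. apply not_all_ex_not in Hx as [k Hk].
    apply imply_to_and in Hk as [Hk1 Hk2].
    destruct (HV1 k x Hk1) as [e [He H]]. exists e. split; [exact He|].
    intros y Hy Hc. apply Hk2. apply Hc; auto.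
  - intros k [x [Hx1 Hx2]]. split.
    + apply (upper_box_dim_not_le rho rho_pseudo).
      * exists x; auto.
      * apply (subset_totally_bounded rho Hmet Hcpt).
      * intros Hle. apply (Hin k x); auto. exists (fun _ y => V k y /\ C y).
        split; [intros; exists 0%nat; auto|]. intros _. right. exact Hle.
    + intros y r T [Hy1 Hy2] Hr.
      destruct (NoDup_list_of_unbounded (fun z => (V k z /\ C z) /\ rho y z < r)) with (T := T)
        as [l Hl]; eauto.
      intros l. apply NNPP. intros Hn.
      destruct (HV1 k y Hy1) as [e [He Hopen]].
      destruct (HV2 y (Rmin e r)) as [j [Hj1 Hj2]]; [apply Rmin_pos; auto|].
      apply (Hin j y Hj1 Hy2). eapply small_incl; [|exact (small_list s l)].
      intros z [Hz1 Hz2]. apply NNPP. intros hz. apply Hn. exists z.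
      specialize (Hj2 z Hz1). pose proof (Rmin_l e r). pose proof (Rmin_r e r).
      repeat split; auto; [apply Hopen|]; lra.
Qed.

(** * Dimension of the graph from below *)

Definition graph_separated (f : X -> nat -> R) (n : nat) (l : list X) : Prop :=
  NoDup l /\ forall x y, In x l -> In y l -> x <> y ->
    graph_dist rho d (x, f x) (y, f y) > (/2) ^ n.

(** Allows the points of [l] to be moved into a set that is merely dense near them. *)
Lemma graph_separated_stable f n l : inC rho d f -> graph_separated f n l ->
  exists r, 0 < r /\ forall x y x' y', In x l -> In y l -> x <> y ->
    rho x x' < r -> rho y y' < r -> graph_dist rho d (x', f x') (y', f y') > (/2) ^ n.
Proof.
  intros [_ Hf] [_ Hl].
  destruct (list_uniform_radius (list_prod l l) (fun p r => fst p <> snd p ->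
    forall x' y', rho (fst p) x' < r -> rho (snd p) y' < r ->
      graph_dist rho d (x', f x') (y', f y') > (/2) ^ n)) as [r [Hr H]].
  - intros p r r' _ h1 h2 hp x' y' hx hy. apply h1; auto; lra.
  - intros [x y] Hp. apply in_prod_iff in Hp as [Hx Hy]. simpl.
    destruct (classic (x = y)) as [e|hn]; [exists 1; split; [lra|tauto]|].
    specialize (Hl x y Hx Hy hn).
    set (gap := graph_dist rho d (x, f x) (y, f y) - (/2) ^ n) in *.
    assert (0 < gap) by (unfold gap; lra).
    destruct (Hf x (gap / 8) ltac:(lra)) as [r1 [Hr1 H1]].
    destruct (Hf y (gap / 8) ltac:(lra)) as [r2 [Hr2 H2]].
    (* Each graph point moves by less than [gap / 4], an eighth in [K] and an eighth in the value,
       so at least half of [gap] survives. *)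
    exists (Rmin (gap / 8) (Rmin r1 r2)). split; [repeat apply Rmin_pos; lra|].
    intros _ x' y' hx hy.
    pose proof (Rmin_l (gap / 8) (Rmin r1 r2)). pose proof (Rmin_r (gap / 8) (Rmin r1 r2)).
    pose proof (Rmin_l r1 r2). pose proof (Rmin_r r1 r2).
    specialize (H1 x' ltac:(lra)). specialize (H2 y' ltac:(lra)).
    pose proof (graph_dist_le rho Hmet d (x', f x') (x, f x)) as g1.
    pose proof (graph_dist_le rho Hmet d (y', f y') (y, f y)) as g2. simpl in g1, g2.
    pose proof gd_pseudo as [_ [Gs Gt]]. pose proof Hmet as [_ [_ [Ms _]]].
    rewrite (Ms x' x) in g1. rewrite (Ms y' y) in g2.
    pose proof (Gt (x, f x) (x', f x') (y, f y)) as t1.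
    pose proof (Gt (x', f x') (y', f y') (y, f y)) as t2.
    rewrite (Gs (x, f x) (x', f x')) in t1. unfold gap in *. lra.
  - exists r. split; auto. intros x y x' y' hx hy hn.
    apply (H (x, y)); auto. apply in_prod_iff. auto.
Qed.

(** The traces [B i] of the cover on [K] cover [C]. By Baire one of them is dense near a whole
    nonempty piece of [C], and the separated lists of that piece can be moved into it without losing
    their separation. *)
Lemma graph_cover_dim_ge V C f tau : countable_base V -> inC rho d f ->
  nonempty_set C -> m_open rho (fun x => ~ C x) ->
  (forall k, nonempty_set (fun x => V k x /\ C x) -> forall N, exists n l, (N <= n)%nat /\
    (forall x, In x l -> V k x /\ C x) /\ graph_separated f n l /\
    Rpower 2 (INR n * (tau + INR d)) <= INR (length l)) ->
  forall (A : nat -> X * (nat -> R) -> Prop) v,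
    (forall p, graph f p -> exists i, A i p) ->
    (forall i, Rbar_le (upper_box_dim (graph_dist rho d) (A i)) (Finite v)) ->
    tau + INR d <= v.
Proof.
  intros [HV1 HV2] Hf [c0 Hc0] HC Hrich A v Hcov Hv.
  pose proof Hmet as [Hpos [_ [Hs Ht]]].
  set (B := fun i x => A i (x, f x)).
  assert (exists i k, nonempty_set (fun x => V k x /\ C x) /\
    forall x r, V k x -> C x -> 0 < r -> exists z, B i z /\ rho x z < r) as [i [k [Hne Hdense]]].
  { apply NNPP. intros Hno.
    destruct (baire rho C (fun i y => exists r, 0 < r /\ forall z, B i z -> ~ rho y z < r) c0)
      as [y [Hy1 Hy2]]; auto.
    - intros x _. apply (metric_refl rho Hmet).
    - intros u Hu Hcau. destruct (compact_complete rho Hmet Hcpt u Hcau) as [y Hy].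
      exists y. split; auto. apply NNPP. intros hy. destruct (HC y hy) as [e [He H]].
      destruct (Hy e He) as [N HN]. apply (H (u N)); auto. rewrite Hs. auto.
    - intros i y _ [r [Hr H]]. exists (r / 2). split; [lra|]. intros z _ Hz.
      exists (r / 2). split; [lra|]. intros w Hw hlt. apply (H w Hw).
      specialize (Ht y z w). lra.
    - intros i y e Hy He. apply NNPP. intros Hn. apply Hno.
      destruct (HV2 y e He) as [k [Hk1 Hk2]]. exists i, k. split; [exists y; auto|].
      intros x r Hx Hcx Hr. apply NNPP. intros Hz. apply Hn.
      exists x. split; auto. split; auto. exists r. split; auto.
      intros z h1 h2. apply Hz. eauto.
    - destruct (Hcov (y, f y)) as [i Hi]; [exists y; auto|].
      destruct (Hy2 i) as [r [Hr H]]. apply (H y Hi). rewrite (metric_refl rho Hmet). auto. }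
  apply Rnot_lt_le. intros Hlt. set (e := tau + INR d - v).
  destruct (proj1 (upper_box_dim_le_iff _ gd_pseudo (A i) v) (Hv i)) as [_ [_ Hub]].
  destruct (Hub (e / 2) ltac:(unfold e; lra)) as [N HN].
  destruct (Hrich k Hne (N + 1)%nat) as [n [l [Hn [Hl1 [Hl2 Hl3]]]]].
  destruct (graph_separated_stable f n l Hf Hl2) as [r [Hr Hst]].
  (* [phi x] need not lie in [C]; it only has to lie in [B i] and close to [x]. *)
  destruct (choice (fun x z => In x l -> B i z /\ rho x z < r)) as [phi Hphi].
  { intros x. destruct (classic (In x l)) as [h|h]; [|exists x; tauto].
    destruct (Hl1 x h) as [h1 h2]. destruct (Hdense x r h1 h2 Hr) as [z Hz]. exists z; auto. }
  assert (Hfar : forall x y, In x l -> In y l -> x <> y ->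
    graph_dist rho d (phi x, f (phi x)) (phi y, f (phi y)) > (/2) ^ n).
  { intros x y hx hy hn. apply (Hst x y); auto; apply Hphi; auto. }
  specialize (HN n (map (fun x => (phi x, f (phi x))) l) ltac:(lia)).
  rewrite length_map in HN.
  assert (INR (length l) <= Rpower 2 (INR n * (v + e / 2))) as Hle.
  { apply HN. split; [|split].
    - apply NoDup_map_NoDup_ForallPairs; [|apply Hl2].
      intros x y hx hy heq. apply NNPP. intros hn. pose proof (Hfar x y hx hy hn) as h.
      rewrite heq in h. pose proof gd_pseudo as [G0 _]. rewrite G0 in h.
      pose proof (pow_half_pos n). lra.
    - intros p hp. apply in_map_iff in hp as [x [<- hx]]. apply Hphi; auto.
    - intros p q hp hq hn. apply in_map_iff in hp as [x [<- hx]].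
      apply in_map_iff in hq as [y [<- hy]]. apply Hfar; auto. congruence. }
  assert (Rpower 2 (INR n * (v + e / 2)) < Rpower 2 (INR n * (tau + INR d))); [|lra].
  apply Rpower_lt; [lra|]. apply Rmult_lt_compat_l; [|unfold e; lra].
  apply lt_0_INR. lia.
Qed.

End Dimension.

(** * The generic map *)

Lemma exp_beats_linear C : exists p0 : nat, forall p, (p0 <= p)%nat -> C * (INR p + 1) <= 2 ^ p.
Proof.
  assert (H : forall p, INR p * (INR p + 1) <= 2 * 2 ^ p).
  { intros p. do 2 (destruct p as [|p]; [simpl; lra|]).
    induction p as [|p IH]; [simpl; lra|].
    rewrite !S_INR in *. simpl pow in *. pose proof (pos_INR p). nra. }
  destruct (INR_unbounded (2 * C)) as [p0 Hp0]. exists p0. intros p Hp.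
  apply le_INR in Hp. specialize (H p). pose proof (pos_INR p). nra.
Qed.

(** Takes [k = n - p] with [p] the quotient of [n] by [e], where [e] exceeds [2 * INR d / eta]. Then
    [p] costs at most half of [INR n * eta] in the exponent, and the other half pays for the summand
    1, a factor 2 in [budget]. On the other side 2^p grows exponentially in [n] and beats the linear
    factor [k]. *)
Lemma scale_choice (d : nat) eta C : 0 < eta -> 0 < C ->
  exists n0 : nat, forall n, (n0 <= n)%nat -> exists k : nat,
    1 + INR n * (INR d - eta) <= INR k * INR d /\
    C * 2 ^ k * (/2) ^ n * INR k <= 1.
Proof.
  intros Heta HC.
  destruct (INR_unbounded (2 * INR d / eta)) as [e He].
  destruct (INR_unbounded (2 / eta)) as [n1 Hn1].
  pose proof (pos_INR d) as Hd.
  assert (0 <= 2 * INR d / eta).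
  { apply Rmult_le_pos; [lra|]. apply Rlt_le, Rinv_0_lt_compat; auto. }
  assert (0 < INR e) by lra.
  assert (e <> 0%nat) by (intros ->; simpl in *; lra).
  destruct (exp_beats_linear (C * INR e)) as [p0 Hp0].
  exists (max n1 (e * p0)). intros n Hn.
  set (p := (n / e)%nat). exists (n - p)%nat.
  assert (p0 <= p)%nat by (apply Nat.div_le_lower_bound; lia).
  assert (p * e <= n)%nat as Hp1 by (pose proof (Nat.Div0.mul_div_le n e); unfold p; lia).
  assert (n <= e * (p + 1))%nat as Hp2 by (pose proof (Nat.mul_succ_div_gt n e); unfold p; lia).
  assert (p <= n)%nat by nia.
  apply le_INR in Hp1, Hp2. rewrite mult_INR in Hp1, Hp2. rewrite plus_INR in Hp2. simpl (INR 1) in Hp2.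
  rewrite minus_INR by auto.
  assert (2 * INR d < INR e * eta).
  { replace (2 * INR d) with (2 * INR d / eta * eta) by (field; lra).
    apply Rmult_lt_compat_r; lra. }
  assert (INR n1 <= INR n) as Hn1' by (apply le_INR; lia).
  assert (2 < INR n * eta).
  { replace 2 with (2 / eta * eta) by (field; lra).
    apply Rmult_lt_compat_r; lra. }
  pose proof (pos_INR p). pose proof (pos_INR n). split.
  - assert (2 * (INR p * INR d) <= INR n * eta); [|lra]. nra.
  - specialize (Hp0 p ltac:(auto)).
    assert (2 ^ n = 2 ^ (n - p) * 2 ^ p) as E.
    { rewrite <- pow_add. f_equal. lia. }
    assert (0 < 2 ^ p) by (apply pow_lt; lra). assert (0 < 2 ^ (n - p)) by (apply pow_lt; lra).
    rewrite pow_inv, E, Rinv_mult.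
    replace (C * 2 ^ (n - p) * (/ 2 ^ (n - p) * / 2 ^ p) * (INR n - INR p))
      with (C * (INR n - INR p) * / 2 ^ p) by (field; split; lra).
    apply Rmult_le_reg_r with (2 ^ p); auto. rewrite Rmult_assoc, Rinv_l; nra.
Qed.

(** For [r >= 0] the expression is the point of [a - r, a + r] nearest to [u]. It depends
    continuously on [a] and [u], and it will keep an interpolating function close to a given map. *)
Lemma clamp_close r a u a' u' e : Rabs (a' - a) < e -> Rabs (u' - u) < e ->
  Rabs (Rmax (a' - r) (Rmin (a' + r) u') - Rmax (a - r) (Rmin (a + r) u)) < e.
Proof.
  intros H1 H2. apply Rabs_def2 in H1, H2. apply Rabs_def1; unfold Rmax, Rmin;
  repeat destruct (Rle_dec _ _); lra.
Qed.

Lemma clamp_near r a u : 0 <= r -> Rabs (a - Rmax (a - r) (Rmin (a + r) u)) <= r.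
Proof.
  intros H. apply Rabs_le. unfold Rmax, Rmin; repeat destruct (Rle_dec _ _); lra.
Qed.

Lemma clamp_id r a u : Rabs (u - a) <= r -> Rmax (a - r) (Rmin (a + r) u) = u.
Proof.
  intros H. apply Rabs_le_inv in H. unfold Rmax, Rmin; repeat destruct (Rle_dec _ _); lra.
Qed.

Section Generic.
Context {X : Type} (rho : X -> X -> R) (Hmet : is_metric rho) (Hcpt : m_compact rho).
Context (d : nat) (Hd : (1 <= d)%nat) (x0 : X).

(* The bump [Rmax 0 (1 - rho x p / r)] corrects the value at one point [p] at a time. *)
Lemma interpolation {A} (l : list A) (pt : A -> X) (c : A -> R) :
  (forall a b, In a l -> In b l -> pt a = pt b -> a = b) ->
  exists u : X -> R, (forall x e, 0 < e -> exists r, 0 < r /\ forall y, rho x y < r -> Rabs (u y - u x) < e) /\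
    forall a, In a l -> u (pt a) = c a.
Proof.
  induction l as [|a l IH]; intros Hinj.
  - exists (fun _ => 0). split; [|simpl; tauto].
    intros x e He. exists 1. split; [lra|]. intros. rewrite Rminus_diag, Rabs_R0. auto.
  - destruct IH as [u [Hu1 Hu2]]; [intros; apply Hinj; simpl; auto|].
    destruct (classic (In a l)) as [Ha|Ha].
    { exists u. split; auto. intros b [<-|Hb]; auto. }
    destruct (list_uniform_radius l (fun b r => r <= rho (pt b) (pt a))) as [r [Hr Hfar]].
    { intros; lra. }
    { intros b Hb. exists (rho (pt b) (pt a)). split; [|lra].
      apply metric_pos; auto. intros e. apply Ha. rewrite <- (Hinj b a); simpl; auto. }
    set (K := c a - u (pt a)).
    assert (Hs : forall x y, rho x y = rho y x) by apply Hmet.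
    assert (Ht : forall x y z, rho x z <= rho x y + rho y z) by apply Hmet.
    exists (fun x => u x + K * Rmax 0 (1 - rho x (pt a) / r)). split.
    + intros x e He. destruct (Hu1 x (e / 2) ltac:(lra)) as [r1 [Hr1 H1]].
      set (M := Rabs K + 1). assert (0 < M) by (unfold M; pose proof (Rabs_pos K); lra).
      set (q := e / 2 / M). assert (0 < q) by (unfold q; repeat apply Rdiv_lt_0_compat; lra).
      exists (Rmin r1 (r * q)). split; [apply Rmin_pos; nra|].
      intros y Hy. pose proof (Rmin_l r1 (r * q)). pose proof (Rmin_r r1 (r * q)).
      specialize (H1 y ltac:(lra)).
      replace (u y + K * Rmax 0 (1 - rho y (pt a) / r) - (u x + K * Rmax 0 (1 - rho x (pt a) / r)))
        with (u y - u x + K * (Rmax 0 (1 - rho y (pt a) / r) - Rmax 0 (1 - rho x (pt a) / r))) by ring.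
      eapply Rle_lt_trans; [apply Rabs_triang|]. rewrite Rabs_mult.
      assert (Rabs (Rmax 0 (1 - rho y (pt a) / r) - Rmax 0 (1 - rho x (pt a) / r)) <= q) as Hq.
      { assert (Rabs (rho y (pt a) / r - rho x (pt a) / r) <= q) as h.
        { replace (rho y (pt a) / r - rho x (pt a) / r) with ((rho y (pt a) - rho x (pt a)) / r) by (field; lra).
          pose proof (Ht x y (pt a)). pose proof (Ht y x (pt a)). rewrite (Hs y x) in *.
          apply Rabs_le. split; apply Rmult_le_reg_r with r; auto; unfold Rdiv;
          rewrite ?(Rmult_assoc (_ - _)), ?Rinv_l; lra. }
        apply Rabs_le_inv in h. apply Rabs_le. unfold Rmax.
        repeat destruct (Rle_dec _ _); lra. }
      assert (Rabs K * Rabs (Rmax 0 (1 - rho y (pt a) / r) - Rmax 0 (1 - rho x (pt a) / r)) <= M * q).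
      { apply Rmult_le_compat; auto using Rabs_pos. unfold M; lra. }
      assert (M * q = e / 2) by (unfold q; field; lra). lra.
    + intros b [<-|Hb].
      * rewrite (metric_refl rho Hmet). unfold Rdiv. rewrite Rmult_0_l, Rminus_0_r, Rmax_right by lra.
        unfold K. ring.
      * rewrite (Hu2 b Hb), Rmax_left; [ring|]. specialize (Hfar b Hb).
        assert (1 <= rho (pt b) (pt a) / r); [|lra].
        apply Rmult_le_reg_r with r; auto. unfold Rdiv. rewrite Rmult_assoc, Rinv_l; lra.
Qed.

(* [J] clusters of [2 ^ (k d)] points of [S]; points of different clusters are
   [2 ^ (-n)]-separated, and [g] spreads each cluster like a grid of mesh [w]. *)
Definition spread (g : X -> nat -> R) (S : X -> Prop) (n k J : nat) (w : R)
  (x : nat -> (nat -> nat) -> X) : Prop :=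
  (forall j m, (j < J)%nat -> In m (grid d (2 ^ k)) -> S (x j m)) /\
  (forall j j' m m', (j < J)%nat -> (j' < J)%nat -> In m (grid d (2 ^ k)) ->
     In m' (grid d (2 ^ k)) -> j <> j' -> rho (x j m) (x j' m') > (/2) ^ n) /\
  (forall j m m' i, (j < J)%nat -> In m (grid d (2 ^ k)) -> In m' (grid d (2 ^ k)) ->
     (i < d)%nat -> w * Rabs (INR (m i) - INR (m' i)) <= Rabs (g (x j m) i - g (x j m') i)).

(* The third condition makes the expected number of collision partners of a point at most
   [1 / (N + 1)]; the fourth makes half of the [J * 2 ^ (k d)] points numerous enough. *)
Definition budget (s eta : R) (N n k J : nat) (w : R) : Prop :=
  (N <= n)%nat /\ 0 < w /\
  4 * (/2) ^ n / w * INR k * 2 ^ d * (INR N + 1) <= 1 /\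
  2 * Rpower 2 (INR n * (s - eta + INR d)) <= INR (J * (2 ^ k) ^ d).

(** Around each point of a large separated list of [S], a cluster of points of [S] is taken so tight
    that [g0] hardly varies on it. Small grid displacements are then prescribed on the cluster;
    perfectness provides enough points, and interpolation makes the change continuous. *)
Lemma spread_dense g0 e S s eta N : inC rho d g0 -> 0 < e -> rich rho s S -> 0 < eta ->
  exists g n k J w x, inC rho d g /\ cdist d g0 g < e /\
    budget s eta N n k J w /\ spread g S n k J (2 * w) x.
Proof.
  intros Hg0 He [Hrich1 Hrich2] Heta.
  assert (1 <= INR d) as Hd1 by (apply (le_INR 1); auto).
  (* A change of at most [e1] in each coordinate changes the map by at most [e / 2] in [cdist]. *)
  set (e1 := e / (2 * INR d)). assert (0 < e1) by (apply Rdiv_lt_0_compat; lra).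
  (* Chosen so that the second inequality of [scale_choice] becomes the third condition of [budget]
     for the [w] below. *)
  set (C := 8 * 2 ^ d * (INR N + 1) / (e1 / 2)).
  assert (0 < 2 ^ d) by (apply pow_lt; lra). pose proof (pos_INR N).
  assert (0 < C) by (apply Rdiv_lt_0_compat; [nra|lra]).
  destruct (scale_choice d eta C Heta) as [n0 Hn0]; auto.
  destruct (Hrich1 (N + n0)%nat) as [n [l [Hn [[Hl1 [Hl2 Hl3]] Hl4]]]].
  destruct (Hn0 n ltac:(lia)) as [k [Hk1 Hk2]].
  set (J := length l). assert (0 < 2 ^ k) by (apply pow_lt; lra).
  (* The grid of mesh [2 * w] has side [e1 / 2]; the other half of [e1] is left for the variation of
     [g0] on a cluster. *)
  set (w := e1 / 2 / (2 * 2 ^ k)). assert (0 < w) by (apply Rdiv_lt_0_compat; lra).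
  set (G := grid d (2 ^ k)).
  set (y := fun j => nth j l x0).
  assert (Hy : forall j, (j < J)%nat -> In (y j) l) by (intros; apply nth_In; auto).
  assert (Hs : forall x y, rho x y = rho y x) by apply Hmet.
  assert (Ht : forall x y z, rho x z <= rho x y + rho y z) by apply Hmet.
  destruct (list_uniform_radius (list_prod l l) (fun p r => fst p <> snd p ->
    forall z z', rho (fst p) z < r -> rho (snd p) z' < r -> rho z z' > (/2) ^ n)) as [r1 [Hr1 Hfar]].
  { intros p r r' _ h hr hp z z' h1 h2. apply h; auto; lra. }
  { intros [a b] Hp. apply in_prod_iff in Hp as [Ha Hb]. simpl.
    destruct (classic (a = b)) as [E|hn]; [exists 1; split; [lra|tauto]|].
    specialize (Hl3 a b Ha Hb hn).
    exists ((rho a b - (/2) ^ n) / 2). split; [lra|]. intros _ z z' h1 h2.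
    pose proof (Ht a z b). pose proof (Ht z z' b). rewrite (Hs z' b) in *. lra. }
  destruct (list_uniform_radius l (fun a r => forall z, rho a z < r ->
    forall i, (i < d)%nat -> Rabs (g0 z i - g0 a i) < e1 / 2)) as [r2 [Hr2 Hnear]].
  { intros a r r' _ h hr z hz. apply h; lra. }
  { intros a _. apply (inC_coord rho d) in Hg0 as [_ Hg0]. apply Hg0. lra. }
  (* [r1] keeps different clusters separated, [r2] bounds the variation of [g0] on a cluster. *)
  set (r := Rmin r1 r2). assert (0 < r) by (apply Rmin_pos; auto).
  assert (r <= r1) by apply Rmin_l. assert (r <= r2) by apply Rmin_r.
  destruct (choice (fun j (phi : (nat -> nat) -> X) => (j < J)%nat ->
     (forall m, In m G -> S (phi m) /\ rho (y j) (phi m) < r) /\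
     (forall m m', In m G -> In m' G -> phi m = phi m' -> m = m'))) as [x Hx].
  { intros j. destruct (Nat.lt_ge_cases j J) as [hj|hj]; [|exists (fun _ => x0); lia].
    destruct (Hrich2 (y j) r (length G)) as [lj [A1 [A2 A3]]]; auto.
    destruct (injection_between_lists G lj x0 A1) as [phi [B1 B2]]; [lia|apply grid_NoDup|].
    exists phi. auto. }
  assert (Hsep : forall j j' m m', (j < J)%nat -> (j' < J)%nat -> In m G -> In m' G ->
    j <> j' -> rho (x j m) (x j' m') > (/2) ^ n).
  { intros j j' m m' hj hj' hm hm' hn. apply (Hfar (y j, y j')); simpl.
    - apply in_prod_iff; auto.
    - intros E. apply hn. eapply NoDup_nth with (d := x0); eauto.
    - pose proof (proj2 (proj1 (Hx j hj) m hm)). lra.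
    - pose proof (proj2 (proj1 (Hx j' hj') m' hm')). lra. }
  destruct (choice (fun i (u : X -> R) =>
     (forall z e, 0 < e -> exists r, 0 < r /\ forall z', rho z z' < r -> Rabs (u z' - u z) < e) /\
     forall p, In p (list_prod (seq 0 J) G) ->
       u (x (fst p) (snd p)) = g0 (y (fst p)) i + 2 * w * INR (snd p i))) as [u Hu].
  { intros i. apply (interpolation (list_prod (seq 0 J) G) (fun p => x (fst p) (snd p))
      (fun p => g0 (y (fst p)) i + 2 * w * INR (snd p i))).
    intros [j m] [j' m'] Hp Hq E. apply in_prod_iff in Hp as [hj hm], Hq as [hj' hm'].
    apply in_seq in hj, hj'. simpl in E.
    destruct (Nat.eq_dec j j') as [<-|hn].
    - f_equal. apply (proj2 (Hx j ltac:(lia))); auto.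
    - specialize (Hsep j j' m m' ltac:(lia) ltac:(lia) hm hm' hn).
      rewrite E, (metric_refl rho Hmet) in Hsep. pose proof (pow_half_pos n). lra. }
  (* Interpolation controls [u] only at the chosen points. Clamping keeps [g] near [g0] everywhere,
     and the prescribed values lie inside the window and survive. *)
  set (g := fun z i => if Nat.ltb i d then Rmax (g0 z i - e1) (Rmin (g0 z i + e1) (u i z)) else 0).
  assert (Hg : inC rho d g).
  { apply inC_coord; auto. split.
    - intros z i hi. unfold g. destruct (Nat.ltb_spec i d); auto; lia.
    - intros z q Hq.
      destruct (proj2 (proj1 (inC_coord rho d g0) Hg0) z q Hq) as [s1 [Hs1 Hg1]].
      destruct (list_uniform_radius (seq 0 d) (fun i r => forall z', rho z z' < r -> Rabs (u i z' - u i z) < q))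
        as [s2 [Hs2 Hu2]].
      + intros i a b _ h1 h2 z' hz. apply h1. lra.
      + intros i _. apply (proj1 (Hu i)). auto.
      + exists (Rmin s1 s2). split; [apply Rmin_pos; auto|]. intros z' hz i hi.
        pose proof (Rmin_l s1 s2). pose proof (Rmin_r s1 s2).
        unfold g. destruct (Nat.ltb_spec i d); [|lia].
        apply clamp_close; [apply Hg1; auto; lra|apply Hu2; [apply in_seq; lia|lra]]. }
  assert (Hval : forall j m i, (j < J)%nat -> In m G -> (i < d)%nat ->
    g (x j m) i = g0 (y j) i + 2 * w * INR (m i)).
  { intros j m i hj hm hi. unfold g. destruct (Nat.ltb_spec i d); [|lia].
    pose proof (proj2 (Hu i) (j, m)) as E. simpl in E. rewrite E; [apply clamp_id|].
    - destruct (proj1 (Hx j hj) m hm) as [_ hr].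
      specialize (Hnear (y j) (Hy j hj) (x j m) ltac:(lra) i hi).
      apply grid_spec in hm as [hm _]. specialize (hm i hi).
      assert (INR (m i) <= 2 ^ k) as hm'.
      { change 2 with (INR 2). rewrite <- pow_INR. apply le_INR. lia. }
      pose proof (pos_INR (m i)).
      assert (2 * w * 2 ^ k = e1 / 2) by (unfold w; field; lra).
      assert (0 <= 2 * w * INR (m i) <= e1 / 2) by nra.
      apply Rabs_def2 in Hnear. apply Rabs_le. lra.
    - apply in_prod_iff. split; auto. apply in_seq. lia. }
  exists g, n, k, J, w, x. split; auto. split; [|split].
  - apply Rle_lt_trans with (INR d * e1).
    + apply (cdist_le_coord rho Hmet d Hcpt x0); auto; [lra|].
      intros z i hi. unfold g. destruct (Nat.ltb_spec i d); [|lia]. apply clamp_near. lra.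
    + unfold e1. replace (INR d * (e / (2 * INR d))) with (e / 2) by (field; lra). lra.
  - split; [lia|]. split; auto. split.
    + replace (4 * (/2) ^ n / w * INR k * 2 ^ d * (INR N + 1)) with (C * 2 ^ k * (/2) ^ n * INR k); auto.
      unfold C, w. field. split; lra.
    + rewrite mult_INR, pow_INR, pow_INR. fold J in Hl4. change (INR 2) with 2.
      rewrite <- pow_mult, <- Rpower2_INR, mult_INR.
      apply Rle_trans with (Rpower 2 (INR n * s) * Rpower 2 (INR k * INR d)).
      * replace 2 with (Rpower 2 1) at 1 by (apply Rpower_1; lra).
        rewrite <- !Rpower_plus. apply Rpower2_le. lra.
      * apply Rmult_le_compat_r; auto. apply Rlt_le, exp_pos.
  - split; [|split]; auto.
    + intros j m hj hm. apply (proj1 (Hx j hj) m hm).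
    + intros j m m' i hj hm hm' hi. rewrite !Hval; auto.
      replace (g0 (y j) i + 2 * w * INR (m i) - (g0 (y j) i + 2 * w * INR (m' i)))
        with (2 * w * (INR (m i) - INR (m' i))) by ring.
      rewrite Rabs_mult, (Rabs_right (2 * w)); lra.
Qed.

(** The perturbation changes a difference of two values by at most [w]. Different labels are at
    least 1 apart, so half of the mesh [2 * w] pays for this. *)
Lemma spread_perturb g g' S n k J w x : inC rho d g -> inC rho d g' -> 0 < w ->
  cdist d g g' < w / 2 -> spread g' S n k J (2 * w) x -> spread g S n k J w x.
Proof.
  intros Hg Hg' Hw Hc [H1 [H2 H3]]. split; auto. split; auto.
  intros j m m' i hj hm hm' hi. specialize (H3 j m m' i hj hm hm' hi).
  destruct (Nat.eq_dec (m i) (m' i)) as [E|hn].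
  - rewrite E, Rminus_diag, Rabs_R0, Rmult_0_r. apply Rabs_pos.
  - assert (1 <= Rabs (INR (m i) - INR (m' i))).
    { rewrite !INR_IZR_INZ, <- minus_IZR, <- abs_IZR. apply IZR_le. lia. }
    pose proof (cdist_coord rho Hmet d Hcpt x0 g g' (x j m) i Hg Hg' hi) as c1.
    pose proof (cdist_coord rho Hmet d Hcpt x0 g g' (x j m') i Hg Hg' hi) as c2.
    assert (Rabs (g' (x j m) i - g' (x j m') i) <= Rabs (g (x j m) i - g (x j m') i) + w); [|nra].
    revert c1 c2. revert Hc. unfold Rabs; repeat destruct (Rcase_abs _); lra.
Qed.

Theorem generic_map (S : nat -> X -> Prop) (s eta : nat -> R) :
  (forall i, nonempty_set (S i) -> rich rho (s i) (S i)) -> (forall i, 0 < eta i) ->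
  exists g, inC rho d g /\ forall i N, nonempty_set (S i) ->
    exists n k J w x, budget (s i) (eta i) N n k J w /\ spread g (S i) n k J w x.
Proof.
  intros Hrich Heta.
  (* Closeness to a map spread with mesh [2 * w] is open by the triangle inequality, which the weak
     inequalities of [spread] itself are not. The code [q] runs over all pieces and all [N]. *)
  destruct (baire (cdist d) (inC rho d) (fun q g => nonempty_set (S (fst (of_nat q))) ->
    exists n k J w x g', budget (s (fst (of_nat q))) (eta (fst (of_nat q))) (snd (of_nat q)) n k J w /\
      inC rho d g' /\ cdist d g g' < w / 2 /\
      spread g' (S (fst (of_nat q))) n k J (2 * w) x) (fun _ _ => 0)) as [g [Hg1 Hg2]].
  - apply (cdist_refl rho Hmet d Hcpt x0).
  - apply cdist_sym.
  - apply (cdist_triangle rho Hmet d Hcpt x0).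
  - apply (inC_complete rho Hmet d Hcpt x0).
  - intros q g Hg HO. destruct (classic (nonempty_set (S (fst (of_nat q))))) as [h|h].
    + destruct (HO h) as [n [k [J [w [x [g' [A1 [A2 [A3 A4]]]]]]]]].
      exists (w / 2 - cdist d g g'). split; [lra|]. intros z Hz Hd' _.
      exists n, k, J, w, x, g'. repeat (split; auto).
      pose proof (cdist_triangle rho Hmet d Hcpt x0 z g g' Hz Hg A2) as T.
      rewrite (cdist_sym d z g) in T. lra.
    + exists 1. split; [lra|tauto].
  - intros q g e Hg He. destruct (classic (nonempty_set (S (fst (of_nat q))))) as [h|h].
    + destruct (spread_dense g e (S (fst (of_nat q))) (s (fst (of_nat q))) (eta (fst (of_nat q)))
        (snd (of_nat q)) Hg He (Hrich _ h) (Heta _)) as [g' [n [k [J [w [x [A1 [A2 [A3 A4]]]]]]]]].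
      exists g'. split; auto. split; auto. intros _. exists n, k, J, w, x, g'.
      repeat (split; auto). rewrite (cdist_refl rho Hmet d Hcpt x0); auto.
      destruct A3 as [_ [hw _]]. lra.
    + exists g. split; auto. split; [rewrite (cdist_refl rho Hmet d Hcpt x0); auto|tauto].
  - apply inC_zero.
  - exists g. split; auto. intros i N Hne.
    destruct (Hg2 (to_nat (i, N))) as [n [k [J [w [x [g' [A1 [A2 [A3 A4]]]]]]]]];
      rewrite cancel_of_to in *; auto. simpl in *.
    exists n, k, J, w, x. split; auto.
    apply (spread_perturb g g'); auto. apply A1.
Qed.

End Generic.

(** * Finite sums and products *)

Definition rsum {A} (l : list A) (F : A -> R) : R := fold_right (fun a acc => F a + acc) 0 l.

Lemma rsum_app {A} (l l' : list A) F : rsum (l ++ l') F = rsum l F + rsum l' F.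
Proof. induction l; simpl; lra. Qed.

Lemma rsum_map {A B} (f : A -> B) l F : rsum (map f l) F = rsum l (fun a => F (f a)).
Proof. induction l; simpl; [reflexivity|]. rewrite IHl. reflexivity. Qed.

Lemma rsum_le {A} (l : list A) F G : (forall a, In a l -> F a <= G a) -> rsum l F <= rsum l G.
Proof.
  induction l as [|a l IH]; intros H; simpl; [lra|].
  apply Rplus_le_compat; [apply H; simpl; auto|apply IH; intros; apply H; simpl; auto].
Qed.

Lemma rsum_ext {A} (l : list A) F G : (forall a, In a l -> F a = G a) -> rsum l F = rsum l G.
Proof. intros H. apply Rle_antisym; apply rsum_le; intros; rewrite H; auto; lra. Qed.

Lemma rsum_nonneg {A} (l : list A) F : (forall a, In a l -> 0 <= F a) -> 0 <= rsum l F.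
Proof.
  induction l as [|a l IH]; intros H; simpl; [lra|].
  apply Rplus_le_le_0_compat; [apply H; simpl; auto|apply IH; intros; apply H; simpl; auto].
Qed.

Lemma rsum_scal {A} (l : list A) c F : rsum l (fun a => c * F a) = c * rsum l F.
Proof. induction l; simpl; [ring|]. rewrite IHl. ring. Qed.

Lemma rsum_plus {A} (l : list A) F G : rsum l (fun a => F a + G a) = rsum l F + rsum l G.
Proof. induction l; simpl; [ring|]. rewrite IHl. ring. Qed.

Lemma rsum_const {A} (l : list A) c : rsum l (fun _ => c) = INR (length l) * c.
Proof. induction l; cbn [rsum fold_right length] in *; [simpl; ring|]. rewrite S_INR. unfold rsum in IHl. rewrite IHl. ring. Qed.

Lemma rsum_list_prod {A B} (l : list A) (l' : list B) F :
  rsum (list_prod l l') F = rsum l (fun a => rsum l' (fun b => F (a, b))).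
Proof.
  induction l; simpl; [reflexivity|]. rewrite rsum_app, rsum_map, IHl. reflexivity.
Qed.

Lemma le_rsum {A} (l : list A) F a : In a l -> (forall b, In b l -> 0 <= F b) -> F a <= rsum l F.
Proof.
  induction l as [|b l IH]; intros Ha H; [destruct Ha|]. simpl.
  assert (0 <= rsum l F) by (apply rsum_nonneg; intros; apply H; simpl; auto).
  assert (0 <= F b) by (apply H; simpl; auto).
  destruct Ha as [<-|Ha]; [lra|]. specialize (IH Ha (fun c hc => H c (or_intror hc))). lra.
Qed.

Lemma rsum_off_diagonal {A} (l : list A) F a : In a l -> (forall b, In b l -> 0 <= F b) ->
  rsum l (fun b => if excluded_middle_informative (b = a) then 0 else F b) <= rsum l F - F a.
Proof.
  induction l as [|b l IH]; intros Ha H; [destruct Ha|]. simpl.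
  destruct (excluded_middle_informative (b = a)) as [->|hn].
  - assert (rsum l (fun b => if excluded_middle_informative (b = a) then 0 else F b) <= rsum l F); [|lra].
    apply rsum_le. intros c hc. destruct (excluded_middle_informative _); [apply H; simpl; auto|lra].
  - destruct Ha as [e|Ha]; [tauto|]. specialize (IH Ha (fun c hc => H c (or_intror hc))). lra.
Qed.

Definition indicator (P : Prop) : R := if excluded_middle_informative P then 1 else 0.

Lemma indicator_nonneg P : 0 <= indicator P.
Proof. unfold indicator. destruct (excluded_middle_informative P); lra. Qed.

Lemma rsum_indicator_filter {A} (l : list A) (P : A -> Prop) :
  INR (length (filter (fun a => if excluded_middle_informative (P a) then true else false) l)) =
  rsum l (fun a => indicator (P a)).
Proof.
  induction l as [|a l IH]; [reflexivity|]. simpl filter. simpl rsum. unfold indicator at 1.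
  destruct (excluded_middle_informative (P a)).
  - simpl length. rewrite S_INR, IH. unfold rsum. lra.
  - rewrite IH. unfold rsum. lra.
Qed.

Lemma rprod_nonneg d F : (forall i, (i < d)%nat -> 0 <= F i) -> 0 <= rprod d F.
Proof.
  induction d; intros H; simpl; [lra|]. apply Rmult_le_pos; auto.
Qed.

Lemma rprod_le d F G : (forall i, (i < d)%nat -> 0 <= F i <= G i) -> rprod d F <= rprod d G.
Proof.
  induction d; intros H; simpl; [lra|].
  apply Rmult_le_compat; try apply H; auto.
  apply rprod_nonneg. intros i hi. apply H. auto.
Qed.

Lemma rprod_ext d F G : (forall i, (i < d)%nat -> F i = G i) -> rprod d F = rprod d G.
Proof. induction d; intros H; simpl; auto. rewrite IHd, H; auto. Qed.

Lemma rprod_const d c : rprod d (fun _ => c) = c ^ d.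
Proof. induction d; simpl; auto. rewrite IHd. ring. Qed.

(** Distributivity: it reduces the count of collisions on a [d]-dimensional grid to sums along a
    single axis. *)
Lemma rsum_grid d L (F : nat -> nat -> R) :
  rsum (grid d L) (fun m => rprod d (fun i => F i (m i))) =
  rprod d (fun i => rsum (seq 0 L) (F i)).
Proof.
  induction d as [|k IH]; simpl; [unfold rsum; simpl; ring|].
  rewrite rsum_map, rsum_list_prod, <- IH.
  rewrite Rmult_comm, <- rsum_scal. apply rsum_ext. intros m _. simpl.
  rewrite Rmult_comm, <- rsum_scal. apply rsum_ext. intros a _.
  rewrite Nat.eqb_refl. f_equal.
  apply rprod_ext. intros i hi. destruct (Nat.eqb_spec i k); auto; lia.
Qed.

Lemma rsum_rev_seq a G : rsum (seq 0 a) (fun b => G (a - b)%nat) = rsum (seq 1 a) G.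
Proof.
  induction a as [|a IH]; [reflexivity|].
  rewrite (seq_S a 1), rsum_app, <- IH. simpl seq. simpl rsum at 1.
  rewrite <- seq_shift, rsum_map. simpl rsum. unfold rsum. simpl. lra.
Qed.

Lemma rsum_shift_seq a s c G : rsum (seq (a + s) c) (fun b => G (b - a)%nat) = rsum (seq s c) G.
Proof.
  revert s. induction c as [|c IH]; intros s; [reflexivity|]. simpl.
  replace (S (a + s)) with (a + S s)%nat by lia. rewrite IH. do 2 f_equal. lia.
Qed.

(** Each of the [k] dyadic blocks contributes at most 1. *)
Lemma harmonic_dyadic k : rsum (seq 1 (2 ^ k - 1)) (fun c => / INR c) <= INR k.
Proof.
  induction k as [|k IH]; [simpl; lra|].
  assert (0 < 2 ^ k)%nat by (apply Nat.neq_0_lt_0, Nat.pow_nonzero; lia).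
  replace (2 ^ S k - 1)%nat with ((2 ^ k - 1) + 2 ^ k)%nat by (simpl; lia).
  rewrite seq_app, rsum_app, S_INR. apply Rplus_le_compat; auto.
  apply Rle_trans with (rsum (seq (1 + (2 ^ k - 1)) (2 ^ k)) (fun _ => / INR (2 ^ k))).
  - apply rsum_le. intros c hc. apply in_seq in hc.
    apply Rinv_le_contravar; [apply lt_0_INR; auto|apply le_INR; lia].
  - rewrite rsum_const, length_seq, Rinv_r; [lra|]. apply not_0_INR. lia.
Qed.

(** Bound for the probability that one coordinate of two values is close when the labels there are
    [a] and [b]. Equal labels give no information and get the trivial bound 1. *)
Definition row_weight (q : R) (a b : nat) : R :=
  if Nat.eqb a b then 1 else q / Rabs (INR a - INR b).

Lemma row_weight_nonneg q a b : 0 <= q -> 0 <= row_weight q a b.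
Proof.
  intros hq. unfold row_weight. destruct (Nat.eqb_spec a b); [lra|].
  apply Rmult_le_pos; auto. apply Rlt_le, Rinv_0_lt_compat, Rabs_pos_lt.
  intros h. apply n, INR_eq. lra.
Qed.

Lemma row_weight_sum q a k : 0 <= q -> (a < 2 ^ k)%nat ->
  rsum (seq 0 (2 ^ k)) (row_weight q a) <= 1 + 2 * q * INR k.
Proof.
  intros hq ha. pose proof (harmonic_dyadic k) as Hk.
  assert (Hmono : forall n, (n <= 2 ^ k - 1)%nat -> rsum (seq 1 n) (fun c => / INR c) <= INR k).
  { intros n hn. replace (2 ^ k - 1)%nat with (n + (2 ^ k - 1 - n))%nat in Hk by lia.
    rewrite seq_app, rsum_app in Hk.
    assert (0 <= rsum (seq (1 + n) (2 ^ k - 1 - n)) (fun c => / INR c)); [|lra].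
    apply rsum_nonneg. intros c hc. apply in_seq in hc.
    apply Rlt_le, Rinv_0_lt_compat, lt_0_INR. lia. }
  replace (2 ^ k)%nat with (a + (1 + (2 ^ k - 1 - a)))%nat at 1 by lia.
  rewrite seq_app, rsum_app, seq_app, rsum_app. simpl (0 + a)%nat.
  assert (rsum (seq 0 a) (row_weight q a) = q * rsum (seq 1 a) (fun c => / INR c)) as ->.
  { rewrite <- rsum_rev_seq, <- rsum_scal. apply rsum_ext. intros b hb. apply in_seq in hb.
    unfold row_weight. destruct (Nat.eqb_spec a b); [lia|].
    rewrite minus_INR, Rabs_right by (try lia; apply Rle_ge, Rge_le, Rge_minus, Rle_ge, le_INR; lia).
    reflexivity. }
  assert (rsum (seq a 1) (row_weight q a) = 1) as ->.
  { simpl. unfold row_weight. rewrite Nat.eqb_refl. ring. }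
  assert (rsum (seq (a + 1) (2 ^ k - 1 - a)) (row_weight q a) =
    q * rsum (seq 1 (2 ^ k - 1 - a)) (fun c => / INR c)) as ->.
  { rewrite <- (rsum_shift_seq a 1), <- rsum_scal. apply rsum_ext. intros b hb. apply in_seq in hb.
    unfold row_weight. destruct (Nat.eqb_spec a b); [lia|].
    rewrite minus_INR, Rabs_minus_sym, Rabs_right by (try lia; apply Rge_minus, Rle_ge, le_INR; lia).
    reflexivity. }
  pose proof (Hmono a ltac:(lia)). pose proof (Hmono (2 ^ k - 1 - a)%nat ltac:(lia)). nra.
Qed.

(** The right side is the chord on [0, 1] of a convex function of [y]. *)
Lemma pow_one_plus_le d y : 0 <= y <= 1 -> (1 + y) ^ d <= 1 + (2 ^ d - 1) * y.
Proof.
  intros hy. induction d as [|d IH]; simpl; [lra|].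
  assert (1 <= 2 ^ d) by (apply pow_R1_Rle; lra).
  apply Rle_trans with ((1 + y) * (1 + (2 ^ d - 1) * y)).
  - apply Rmult_le_compat_l; lra.
  - assert (0 <= (2 ^ d - 1) * (y * (1 - y))) by (repeat apply Rmult_le_pos; lra). nra.
Qed.

(** * Consequences of countable additivity *)

Lemma pred_ext {A} (P Q : A -> Prop) : (forall t, P t <-> Q t) -> P = Q.
Proof. intros H. extensionality t. apply propositional_extensionality. auto. Qed.

Section Law.
Context (d : nat) (Meas : ((nat -> R) -> Prop) -> Prop) (lam : ((nat -> R) -> Prop) -> R).
Hypothesis HL : cube_law d Meas lam.

Lemma meas_false : Meas (fun _ => False).
Proof. apply (cl_open _ _ _ HL). tauto. Qed.

Lemma meas_or A B : Meas A -> Meas B -> Meas (fun t => A t \/ B t).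
Proof.
  intros HA HB. replace (fun t => A t \/ B t) with
    (fun t => exists n : nat, (match n with O => A | _ => B end) t).
  - apply (cl_union _ _ _ HL). intros [|n]; auto.
  - apply pred_ext. intros t. split.
    + intros [[|n] h]; auto.
    + intros [h|h]; [exists 0%nat|exists 1%nat]; auto.
Qed.

Lemma meas_and A B : Meas A -> Meas B -> Meas (fun t => A t /\ B t).
Proof.
  intros HA HB. replace (fun t => A t /\ B t) with (fun t => ~ (~ A t \/ ~ B t)).
  - apply (cl_compl _ _ _ HL), meas_or; apply (cl_compl _ _ _ HL); auto.
  - apply pred_ext. intros t. tauto.
Qed.

Lemma meas_closed A :
  (forall t, ~ A t -> exists e, 0 < e /\
     forall u, (forall i, (i < d)%nat -> Rabs (u i - t i) < e) -> ~ A u) -> Meas A.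
Proof.
  intros H. replace A with (fun t => ~ ~ A t).
  - apply (cl_compl _ _ _ HL), (cl_open _ _ _ HL). auto.
  - apply pred_ext. intros t. tauto.
Qed.

(** By countable additivity the series with constant term [c] converges, and consecutive partial
    sums differ by [c]. *)
Lemma lam_false : lam (fun _ => False) = 0.
Proof.
  pose proof (cl_sigma _ _ _ HL (fun _ _ => False) (fun _ => meas_false) (fun _ _ _ _ h _ => h)) as H.
  set (c := lam (fun _ => False)) in *.
  assert (lam (fun _ => exists _ : nat, False) = c) as E
    by (unfold c; f_equal; apply pred_ext; firstorder).
  cbv beta in H. rewrite E in H. fold c in H.
  apply (UL_sequence (fun N => sum_f_R0 (fun _ => c) (S N) - sum_f_R0 (fun _ => c) N)).
  - intros e He. exists 0%nat. intros n _. simpl. unfold Rdist.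
    replace (_ - _) with 0 by ring. rewrite Rabs_R0. auto.
  - replace 0 with (c - c) by ring. apply CV_minus; auto.
    intros e He. destruct (H e He) as [N HN]. exists N. intros n hn. apply HN. lia.
Qed.

Lemma lam_add A B : Meas A -> Meas B -> (forall t, A t -> B t -> False) ->
  lam (fun t => A t \/ B t) = lam A + lam B.
Proof.
  intros HA HB Hdis.
  set (F := fun n : nat => match n with O => A | S O => B | _ => fun _ => False end).
  assert (HF : forall n, Meas (F n)) by (intros [|[|n]]; simpl; auto; apply meas_false).
  pose proof (cl_sigma _ _ _ HL F HF) as H.
  replace (fun t => exists n, F n t) with (fun t => A t \/ B t) in H.
  - apply (UL_sequence (fun N => sum_f_R0 (fun n => lam (F n)) N)).
    + apply H. intros [|[|m]] [|[|n]] t hn; simpl; try tauto; eauto.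
    + intros e He. exists 1%nat. intros n hn.
      assert (sum_f_R0 (fun n => lam (F n)) n = lam A + lam B) as ->.
      { destruct n as [|n]; [lia|]. clear hn. induction n as [|n IH]; [reflexivity|].
        rewrite tech5, IH. simpl. rewrite lam_false. ring. }
      unfold Rdist. rewrite Rminus_diag, Rabs_R0. auto.
  - apply pred_ext. intros t. split.
    + intros [h|h]; [exists 0%nat|exists 1%nat]; auto.
    + intros [[|[|n]] h]; simpl in h; tauto.
Qed.

Lemma lam_split A B : Meas A -> Meas B ->
  lam A = lam (fun t => A t /\ B t) + lam (fun t => A t /\ ~ B t).
Proof.
  intros HA HB. rewrite <- lam_add.
  - f_equal. apply pred_ext. intros t. tauto.
  - apply meas_and; auto.
  - apply meas_and; auto. apply (cl_compl _ _ _ HL). auto.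
  - tauto.
Qed.

Lemma lam_mono A B : Meas A -> Meas B -> (forall t, A t -> B t) -> lam A <= lam B.
Proof.
  intros HA HB H. rewrite (lam_split B A HB HA).
  replace (fun t => B t /\ A t) with A by (apply pred_ext; firstorder).
  assert (0 <= lam (fun t => B t /\ ~ A t)); [|lra].
  apply (cl_ge0 _ _ _ HL), meas_and; auto. apply (cl_compl _ _ _ HL). auto.
Qed.

Lemma lam_null_union (A : nat -> (nat -> R) -> Prop) :
  (forall n, Meas (A n)) -> (forall n, lam (A n) = 0) -> lam (fun t => exists n, A n t) = 0.
Proof.
  intros HA H0.
  assert (Hbefore : forall n, Meas (fun t => exists m, (m < n)%nat /\ A m t)).
  { intros n. replace (fun t => exists m, (m < n)%nat /\ A m t) with
      (fun t => exists m, (if Nat.ltb m n then A m else fun _ => False) t).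
    - apply (cl_union _ _ _ HL). intros m. destruct (Nat.ltb m n); auto. apply meas_false.
    - apply pred_ext. intros t. split; intros [m h]; exists m; destruct (Nat.ltb_spec m n); try tauto; lia. }
  set (F := fun n t => A n t /\ ~ exists m, (m < n)%nat /\ A m t).
  assert (HF : forall n, Meas (F n)).
  { intros n. apply meas_and; auto. apply (cl_compl _ _ _ HL). auto. }
  assert (HF0 : forall n, lam (F n) = 0).
  { intros n. apply Rle_antisym; [|apply (cl_ge0 _ _ _ HL); auto].
    rewrite <- (H0 n). apply lam_mono; auto. intros t [h _]. auto. }
  replace (fun t => exists n, A n t) with (fun t => exists n, F n t).
  - apply (UL_sequence (fun N => sum_f_R0 (fun n => lam (F n)) N)).
    + apply (cl_sigma _ _ _ HL); auto. intros m n t hn [h1 h2] [h3 h4].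
      destruct (Nat.lt_total m n) as [h|[h|h]]; [apply h4|auto|apply h2]; eauto.
    + intros e He. exists 0%nat. intros n _.
      assert (sum_f_R0 (fun n => lam (F n)) n = 0) as ->.
      { induction n as [|n IH]; simpl; rewrite HF0; lra. }
      unfold Rdist. rewrite Rminus_diag, Rabs_R0. auto.
  - apply pred_ext. intros t. split; [intros [n [h _]]; eauto|].
    intros Hex. destruct (dec_inh_nat_subset_has_unique_least_element (fun n => A n t))
      as [n [[h1 h2] _]]; auto.
    { intros n. apply classic. }
    exists n. split; auto. intros [m [hm h]]. specialize (h2 m h). lia.
Qed.

(** Markov's inequality for a sum of indicators, without integrals: [A] is split by the first event,
    and the threshold drops by one on the part where the event occurs. *)
Lemma markov {I} (l : list I) (E : I -> (nat -> R) -> Prop) A c :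
  (forall i, In i l -> Meas (E i)) -> Meas A ->
  (forall t, A t -> c <= rsum l (fun i => indicator (E i t))) ->
  c * lam A <= rsum l (fun i => lam (fun t => A t /\ E i t)).
Proof.
  revert A c. induction l as [|i l IH]; intros A c HE HA Hc.
  - simpl in *. destruct (classic (exists t, A t)) as [[t ht]|hn].
    + pose proof (Hc t ht). pose proof (cl_ge0 _ _ _ HL A HA). nra.
    + replace A with (fun _ : nat -> R => False) by (apply pred_ext; firstorder).
      rewrite lam_false. lra.
  - assert (HEi : Meas (E i)) by (apply HE; simpl; auto).
    assert (HnE : Meas (fun t => ~ E i t)) by (apply (cl_compl _ _ _ HL); auto).
    set (A1 := fun t => A t /\ E i t). set (A2 := fun t => A t /\ ~ E i t).
    assert (M1 : Meas A1) by (apply meas_and; auto).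
    assert (M2 : Meas A2) by (apply meas_and; auto).
    assert (H1 : (c - 1) * lam A1 <= rsum l (fun j => lam (fun t => A1 t /\ E j t))).
    { apply IH; auto; [intros; apply HE; simpl; auto|].
      intros t [h1 h2]. specialize (Hc t h1). simpl in Hc. unfold indicator at 1 in Hc.
      destruct (excluded_middle_informative (E i t)); [unfold rsum in *; lra|tauto]. }
    assert (H2 : c * lam A2 <= rsum l (fun j => lam (fun t => A2 t /\ E j t))).
    { apply IH; auto; [intros; apply HE; simpl; auto|].
      intros t [h1 h2]. specialize (Hc t h1). simpl in Hc. unfold indicator at 1 in Hc.
      destruct (excluded_middle_informative (E i t)); [tauto|unfold rsum in *; lra]. }
    assert (E3 : rsum l (fun j => lam (fun t => A t /\ E j t)) =
      rsum l (fun j => lam (fun t => A1 t /\ E j t)) + rsum l (fun j => lam (fun t => A2 t /\ E j t))).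
    { rewrite <- rsum_plus. apply rsum_ext. intros j hj.
      rewrite (lam_split (fun t => A t /\ E j t) (E i)); auto.
      - f_equal; f_equal; apply pred_ext; unfold A1, A2; tauto.
      - apply meas_and; auto. apply HE. simpl. auto. }
    simpl. fold (rsum l (fun j => lam (fun t => A t /\ E j t))). fold A1.
    rewrite E3. pose proof (lam_split A (E i) HA HEi) as E4. fold A1 A2 in E4. nra.
Qed.

Lemma meas_coordinatewise (Q : nat -> R -> Prop) :
  (forall i u, ~ Q i u -> exists e, 0 < e /\ forall v, Rabs (v - u) < e -> ~ Q i v) ->
  Meas (fun t => forall i, (i < d)%nat -> Q i (t i)).
Proof.
  intros H. apply meas_closed. intros t Ht.
  apply not_all_ex_not in Ht as [i Hi]. apply imply_to_and in Hi as [hi Hi].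
  destruct (H i (t i) Hi) as [e [He He']]. exists e. split; auto.
  intros u Hu Hc. apply (He' (u i)); auto.
Qed.

Lemma meas_slab (a b : nat -> R) r :
  Meas (fun t => forall i, (i < d)%nat -> Rabs (t i * a i - b i) <= r).
Proof.
  apply (meas_coordinatewise (fun i u => Rabs (u * a i - b i) <= r)).
  intros i u Hu. apply Rnot_le_lt in Hu.
  set (gap := Rabs (u * a i - b i) - r) in *.
  pose proof (Rabs_pos (a i)).
  exists (gap / (Rabs (a i) + 1)). split; [apply Rdiv_lt_0_compat; unfold gap; lra|].
  intros v Hv Hc.
  pose proof (Rabs_triang ((u - v) * a i) (v * a i - b i)) as T.
  replace ((u - v) * a i + (v * a i - b i)) with (u * a i - b i) in T by ring.
  rewrite Rabs_mult, (Rabs_minus_sym u v) in T.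
  assert (Rabs (v - u) * Rabs (a i) <= gap / (Rabs (a i) + 1) * Rabs (a i)) by (apply Rmult_le_compat_r; lra).
  assert (gap / (Rabs (a i) + 1) * (Rabs (a i) + 1) = gap) by (field; lra).
  assert (0 < gap / (Rabs (a i) + 1)) by (apply Rdiv_lt_0_compat; unfold gap; lra).
  unfold gap in *. lra.
Qed.

(** The slab confines each [t i] with different labels to an interval of length
    [2 * r / Rabs (a i)], and [cl_box] multiplies these lengths. The position [b], through which the
    translation enters, does not affect the bound. *)
Lemma lam_slab_le (a b : nat -> R) (m m' : nat -> nat) r w : 0 <= r -> 0 < w ->
  (forall i, (d <= i)%nat -> m i = m' i) ->
  (forall i, (i < d)%nat -> w * Rabs (INR (m i) - INR (m' i)) <= Rabs (a i)) ->
  lam (fun t => forall i, (i < d)%nat -> Rabs (t i * a i - b i) <= r) <=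
  rprod d (fun i => row_weight (2 * r / w) (m i) (m' i)).
Proof.
  intros Hr Hw Hout Ha.
  (* [B] marks the coordinates with different labels, all below [d] by [Hout]; the remaining ones
     are left free. *)
  set (B := fun i => negb (Nat.eqb (m i) (m' i))).
  assert (Hgap : forall i, B i = true -> (i < d)%nat /\ 0 < Rabs (INR (m i) - INR (m' i))).
  { intros i Hi. unfold B in Hi. destruct (Nat.eqb_spec (m i) (m' i)) as [|hn]; [discriminate|].
    split.
    - apply Nat.nle_gt. intros h. auto.
    - apply Rabs_pos_lt. intros h. apply hn, INR_eq. lra. }
  assert (Ha0 : forall i, B i = true -> 0 < Rabs (a i)).
  { intros i Hi. destruct (Hgap i Hi) as [h1 h2]. specialize (Ha i h1). nra. }
  set (lo := fun i => if B i then b i / a i - r / Rabs (a i) else 0).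
  set (hi := fun i => if B i then b i / a i + r / Rabs (a i) else 0).
  assert (Hlohi : forall i, lo i <= hi i).
  { intros i. unfold lo, hi. destruct (B i) eqn:E; [|lra].
    assert (0 <= r / Rabs (a i)); [|lra].
    apply Rmult_le_pos; auto. apply Rlt_le, Rinv_0_lt_compat; auto. }
  eapply Rle_trans; [|eapply Rle_trans; [apply (cl_box _ _ _ HL B lo hi Hlohi)|]].
  - apply lam_mono.
    + apply meas_slab.
    + apply (meas_coordinatewise (fun i u => B i = true -> lo i <= u <= hi i)).
      intros i u Hu. apply imply_to_and in Hu as [HB Hu].
      assert (u < lo i \/ hi i < u) as [h|h].
      { destruct (Rlt_le_dec u (lo i)); auto. destruct (Rlt_le_dec (hi i) u); auto. tauto. }
      * exists (lo i - u). split; [lra|]. intros v Hv Hc. apply Rabs_def2 in Hv. specialize (Hc HB). lra.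
      * exists (u - hi i). split; [lra|]. intros v Hv Hc. apply Rabs_def2 in Hv. specialize (Hc HB). lra.
    + intros t Ht i hi' HB. specialize (Ht i hi'). unfold lo, hi. rewrite HB.
      specialize (Ha0 i HB).
      assert (a i <> 0) by (intros h; rewrite h, Rabs_R0 in Ha0; lra).
      assert (Rabs (t i - b i / a i) <= r / Rabs (a i)) as h.
      { apply Rmult_le_reg_r with (Rabs (a i)); auto. rewrite <- Rabs_mult.
        replace ((t i - b i / a i) * a i) with (t i * a i - b i) by (field; auto).
        unfold Rdiv. rewrite Rmult_assoc, Rinv_l; lra. }
      apply Rabs_le_inv in h. lra.
  - apply rprod_le. intros i hi'. specialize (Hlohi i). unfold row_weight.
    destruct (Nat.eqb_spec (m i) (m' i)) as [e|hn].
    + unfold B. rewrite e, Nat.eqb_refl. simpl. lra.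
    + assert (B i = true) as HB.
      { unfold B. destruct (Nat.eqb_spec (m i) (m' i)); auto. }
      rewrite HB. split; [lra|]. unfold lo, hi. rewrite HB.
      specialize (Ha i hi'). destruct (Hgap i HB) as [_ hg]. specialize (Ha0 i HB).
      replace (b i / a i + r / Rabs (a i) - (b i / a i - r / Rabs (a i))) with (2 * r * / Rabs (a i))
        by (unfold Rdiv; ring).
      replace (2 * r / w / Rabs (INR (m i) - INR (m' i)))
        with (2 * r * / (w * Rabs (INR (m i) - INR (m' i)))) by (field; lra).
      apply Rmult_le_compat_l; [lra|]. apply Rinv_le_contravar; nra.
Qed.

End Law.

(** * Collisions and the probe measure *)

Definition probe {X : Type} (g h : X -> nat -> R) (t : nat -> R) : X -> nat -> R :=
  fun x i => t i * g x i - h x i.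

Section Collisions.
Context {X : Type} (rho : X -> X -> R) (Hmet : is_metric rho) (Hcpt : m_compact rho).
Context (d : nat) (x0 : X).
Context (Meas : ((nat -> R) -> Prop) -> Prop) (lam : ((nat -> R) -> Prop) -> R).
Hypothesis HL : cube_law d Meas lam.

(** The sum over all labels factors into [d] row sums and is at most [(1 + y) ^ d]; removing the
    diagonal term, which is 1, leaves a bound linear in [y]. *)
Lemma collision_sum_le (q : R) k m : 0 <= q -> 2 * q * INR k <= 1 -> In m (grid d (2 ^ k)) ->
  rsum (grid d (2 ^ k)) (fun m' => if excluded_middle_informative (m' = m) then 0 else
    rprod d (fun i => row_weight q (m i) (m' i))) <= 2 ^ d * (2 * q * INR k).
Proof.
  intros Hq Hy Hm. pose proof (pos_INR k).
  set (y := 2 * q * INR k) in *. assert (0 <= y) by (unfold y; nra).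
  eapply Rle_trans; [apply (rsum_off_diagonal _ (fun m' => rprod d (fun i => row_weight q (m i) (m' i))))|]; auto.
  - intros m' _. apply rprod_nonneg. intros i _. apply row_weight_nonneg; auto.
  - rewrite (rsum_grid d (2 ^ k) (fun i => row_weight q (m i))).
    rewrite (rprod_ext d (fun i => row_weight q (m i) (m i)) (fun _ => 1)), rprod_const, pow1.
    2:{ intros i _. unfold row_weight. rewrite Nat.eqb_refl. auto. }
    assert (rprod d (fun i => rsum (seq 0 (2 ^ k)) (row_weight q (m i))) <= (1 + y) ^ d).
    { rewrite <- rprod_const. apply rprod_le. intros i hi. split.
      - apply rsum_nonneg. intros b _. apply row_weight_nonneg; auto.
      - apply row_weight_sum; auto. apply grid_spec in Hm as [Hm _]. auto. }
    pose proof (pow_one_plus_le d y ltac:(lra)). lra.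
Qed.

(* The expected number of ordered pairs of colliding points is at most
   [1 / (N + 1)] times the number of points; the points without a collision form a
   separated set, which therefore can miss half of the points only rarely. *)
Lemma lam_few_separated_le g h S s eta N n k J w x Z :
  spread rho d g S n k J w x -> budget d s eta N n k J w -> Meas Z ->
  (forall t, Z t -> forall l, (forall y, In y l -> S y) ->
    graph_separated rho d (probe g h t) n l ->
    INR (length l) < Rpower 2 (INR n * (s - eta + INR d))) ->
  lam Z <= 2 / (INR N + 1).
Proof.
  intros [Hx1 [Hx2 Hx3]] [_ [Hw [Hb1 Hb2]]] HZ Hfew.
  set (G := grid d (2 ^ k)) in *. set (r := (/2) ^ n) in *.
  assert (0 < r) by apply pow_half_pos.
  set (I := list_prod (seq 0 J) G).
  set (T := INR (J * (2 ^ k) ^ d)) in *.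
  assert (HT : INR (length I) = T).
  { unfold I, T, G. rewrite length_prod, length_seq, grid_length. reflexivity. }
  assert (0 < T).
  { assert (0 < Rpower 2 (INR n * (s - eta + INR d))) by apply exp_pos. lra. }
  set (slab := fun (p : nat * (nat -> nat)) m' t => forall i, (i < d)%nat ->
    Rabs (t i * (g (x (fst p) (snd p)) i - g (x (fst p) m') i) -
      (h (x (fst p) (snd p)) i - h (x (fst p) m') i)) <= r).
  set (E := fun (pm : (nat * (nat -> nat)) * (nat -> nat)) t =>
    snd pm <> snd (fst pm) /\ slab (fst pm) (snd pm) t).
  assert (HE : forall pm, Meas (E pm)).
  { intros [p m']. unfold E. simpl. destruct (classic (m' = snd p)) as [e|e].
    - replace (fun t => _) with (fun _ : nat -> R => False); [apply (meas_false _ _ _ HL)|].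
      apply pred_ext. tauto.
    - replace (fun t => _) with (slab p m').
      + apply (meas_slab d Meas lam HL (fun i => g (x (fst p) (snd p)) i - g (x (fst p) m') i)
          (fun i => h (x (fst p) (snd p)) i - h (x (fst p) m') i)).
      + apply pred_ext. tauto. }
  pose proof (pos_INR N). pose proof (pos_INR k).
  set (q := 2 * r / w). assert (0 <= q).
  { unfold q. apply Rmult_le_pos; [lra|]. apply Rlt_le, Rinv_0_lt_compat; auto. }
  assert (Hy : 2 ^ d * (2 * q * INR k) <= / (INR N + 1)).
  { apply Rmult_le_reg_r with (INR N + 1); [lra|]. rewrite Rinv_l by lra.
    replace (2 ^ d * (2 * q * INR k) * (INR N + 1)) with (4 * r / w * INR k * 2 ^ d * (INR N + 1)); auto.
    unfold q. field. lra. }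
  assert (Hy1 : 2 * q * INR k <= 1).
  { assert (1 <= 2 ^ d) by (apply pow_R1_Rle; lra).
    assert (/ (INR N + 1) <= 1) by (rewrite <- Rinv_1; apply Rinv_le_contravar; lra).
    assert (0 <= 2 * q * INR k) by nra. nra. }
  assert (Hexp : rsum (list_prod I G) (fun pm => lam (E pm)) <= T * / (INR N + 1)).
  { rewrite rsum_list_prod, <- HT, <- rsum_const. apply rsum_le.
    intros [j m] Hp. apply in_prod_iff in Hp as [Hj Hm]. apply in_seq in Hj.
    eapply Rle_trans; [|exact Hy]. eapply Rle_trans; [|apply (collision_sum_le q k m); auto].
    apply rsum_le. intros m' Hm'. unfold E. simpl.
    destruct (excluded_middle_informative (m' = m)) as [e|e].
    - replace (fun t => _) with (fun _ : nat -> R => False); [rewrite (lam_false _ _ _ HL); lra|].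
      apply pred_ext. tauto.
    - eapply Rle_trans; [|apply (lam_slab_le d Meas lam HL
        (fun i => g (x j m) i - g (x j m') i) (fun i => h (x j m) i - h (x j m') i) m m' r w); try lra].
      + right. f_equal. apply pred_ext. unfold slab. simpl. tauto.
      + intros i hi. apply grid_spec in Hm as [_ Hm], Hm' as [_ Hm']. rewrite Hm, Hm'; auto.
      + intros i hi. apply Hx3; auto. lia. }
  assert (Hcount : forall t, Z t -> T / 2 <= rsum (list_prod I G) (fun pm => indicator (E pm t))).
  { intros t Ht.
    set (good := fun p => forall m', In m' G -> ~ E (p, m') t).
    set (L := filter (fun p => if excluded_middle_informative (good p) then true else false) I).
    assert (HinL : forall p, In p L <-> In p I /\ good p).
    { intros p. unfold L. rewrite filter_In. destruct (excluded_middle_informative (good p)); intuition discriminate. }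
    assert (Hfar : forall p p', In p L -> In p' L -> p <> p' ->
      graph_dist rho d (x (fst p) (snd p), probe g h t (x (fst p) (snd p)))
        (x (fst p') (snd p'), probe g h t (x (fst p') (snd p'))) > r).
    { intros [j m] [j' m'] Hp Hp' hn. apply HinL in Hp as [Hp1 Hp2], Hp' as [Hp1' _].
      apply in_prod_iff in Hp1 as [Hj Hm], Hp1' as [Hj' Hm']. apply in_seq in Hj, Hj'. simpl.
      (* Two close points of one cluster would form a collision; points of different clusters are
         far apart already in [K]. *)
      destruct (Nat.eq_dec j j') as [<-|hj].
      - apply Rnot_le_gt. intros Hc. apply (Hp2 m' Hm'). split; simpl; [congruence|].
        intros i hi. eapply Rle_trans; [|exact Hc].
        eapply Rle_trans; [|apply (coord_le_graph_dist rho d _ _ i hi)]. simpl. unfold probe.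
        right. f_equal. ring.
      - apply Rlt_le_trans with (rho (x j m) (x j' m')).
        + apply Hx2; auto; lia.
        + apply (rho_le_graph_dist rho d (x j m, _) (x j' m', _)). }
    assert (Hlen : INR (length L) < T / 2).
    { rewrite <- (length_map (fun p => x (fst p) (snd p))).
      eapply Rlt_le_trans; [apply (Hfew t Ht)|lra].
      - intros y hy. apply in_map_iff in hy as [[j m] [<- hp]].
        apply HinL in hp as [hp _]. apply in_prod_iff in hp as [hj hm]. apply in_seq in hj.
        apply Hx1; auto. simpl. lia.
      - split.
        + apply NoDup_map_NoDup_ForallPairs.
          * intros p p' hp hp' e. apply NNPP. intros hn. specialize (Hfar p p' hp hp' hn).
            rewrite e in Hfar. destruct (graph_dist_pseudometric rho Hmet d) as [G0 _].
            rewrite G0 in Hfar. lra.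
          * apply NoDup_filter, NoDup_list_prod; [apply seq_NoDup|apply grid_NoDup].
        + intros y z hy hz hn. apply in_map_iff in hy as [p [<- hp]], hz as [p' [<- hp']].
          apply Hfar; auto. congruence. }
    (* Every point is either free of collisions or the first entry of at least one colliding
       pair. *)
    assert (T <= INR (length L) + rsum (list_prod I G) (fun pm => indicator (E pm t))); [|lra].
    unfold L. rewrite rsum_indicator_filter, rsum_list_prod, <- rsum_plus, <- HT.
    replace (INR (length I)) with (rsum I (fun _ => 1)) by (rewrite rsum_const; ring).
    apply rsum_le. intros p Hp.
    assert (0 <= rsum G (fun m' => indicator (E (p, m') t))).
    { apply rsum_nonneg. intros; apply indicator_nonneg. }
    unfold indicator at 1. destruct (excluded_middle_informative (good p)) as [hg|hg]; [lra|].
    apply not_all_ex_not in hg as [m' hg]. apply imply_to_and in hg as [hm' hg].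
    apply NNPP in hg.
    assert (1 <= rsum G (fun m' => indicator (E (p, m') t))); [|lra].
    eapply Rle_trans; [|apply (le_rsum G _ m' hm')]; [|intros; apply indicator_nonneg].
    unfold indicator. destruct (excluded_middle_informative _); [lra|tauto]. }
  pose proof (markov d Meas lam HL (list_prod I G) E Z (T / 2) (fun pm _ => HE pm) HZ Hcount) as Hmk.
  assert (rsum (list_prod I G) (fun pm => lam (fun t => Z t /\ E pm t)) <=
    rsum (list_prod I G) (fun pm => lam (E pm))).
  { apply rsum_le. intros pm _. apply (lam_mono d Meas lam HL); auto.
    - apply (meas_and d Meas lam HL); auto.
    - tauto. }
  apply Rmult_le_reg_l with (T / 2); [lra|].
  apply Rle_trans with (T * / (INR N + 1)); [lra|]. right. field. lra.
Qed.

Lemma probe_inC g h t : inC rho d g -> inC rho d h -> inC rho d (probe g h t).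
Proof.
  intros Hg Hh. apply (inC_minus rho d (fun x i => t i * g x i) h); auto.
  apply inC_scale; auto.
Qed.

Lemma probe_continuous g h t e : inC rho d g -> inC rho d h -> 0 < e ->
  exists r, 0 < r /\ forall u, (forall i, (i < d)%nat -> Rabs (u i - t i) < r) ->
    cdist d (probe g h t) (probe g h u) < e.
Proof.
  intros Hg Hh He. destruct (inC_bounded rho Hmet d Hcpt g Hg) as [M [HM Hb]].
  pose proof (pos_INR d).
  assert (0 < e / (INR d + 1)) by (apply Rdiv_lt_0_compat; lra).
  exists (e / (INR d + 1) / M). split; [apply Rdiv_lt_0_compat; auto|].
  intros u Hu. apply Rle_lt_trans with (INR d * (e / (INR d + 1))).
  - apply (cdist_le_coord rho Hmet d Hcpt x0); try lra; try (apply probe_inC; auto).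
    intros x i hi. unfold probe.
    replace (t i * g x i - h x i - (u i * g x i - h x i)) with (- ((u i - t i) * g x i)) by ring.
    rewrite Rabs_Ropp, Rabs_mult. specialize (Hu i hi). specialize (Hb x i).
    replace (e / (INR d + 1)) with (e / (INR d + 1) / M * M) by (field; lra).
    apply Rmult_le_compat; auto using Rabs_pos. lra.
  - apply Rmult_lt_reg_r with (INR d + 1); [lra|]. unfold Rdiv.
    rewrite Rmult_assoc, Rmult_assoc, Rinv_l; nra.
Qed.

Lemma probe_measurable g h A : inC rho d g -> inC rho d h -> C_Borel rho d A ->
  Meas (fun t => A (probe g h t)).
Proof.
  intros Hg Hh HA. induction HA as [U [HU1 HU2]|A HA IH|A HA IH].
  - apply (cl_open _ _ _ HL). intros t Ht. destruct (HU2 _ Ht) as [e [He H]].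
    destruct (probe_continuous g h t e Hg Hh He) as [r [Hr Hc]].
    exists r. split; auto. intros u Hu. apply H; auto. apply probe_inC; auto.
  - replace (fun t => _) with (fun t => ~ A (probe g h t)).
    + apply (cl_compl _ _ _ HL). auto.
    + apply pred_ext. intros t. pose proof (probe_inC g h t Hg Hh). tauto.
  - apply (cl_union _ _ _ HL). auto.
Qed.

Lemma probe_law_Borel_prob g : inC rho d g ->
  Borel_prob rho d (fun A : (X -> nat -> R) -> Prop => lam (fun t => A (probe g (fun _ _ => 0) t))).
Proof.
  intros Hg. pose proof (inC_zero rho d) as H0. split; [|split].
  - rewrite <- (cl_full _ _ _ HL). f_equal. apply pred_ext. intros t.
    pose proof (probe_inC g _ t Hg H0). tauto.
  - intros B HB. apply (cl_ge0 _ _ _ HL). apply probe_measurable; auto.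
  - intros A HA Hdis.
    apply (cl_sigma _ _ _ HL (fun n t => A n (probe g (fun _ _ => 0) t))).
    + intros n. apply probe_measurable; auto.
    + intros m n t. apply Hdis.
Qed.

Lemma translate_probe (g h : X -> nat -> R) B t :
  translate B h (probe g (fun _ _ => 0) t) <-> B (probe g h t).
Proof.
  split.
  - intros [b [Hb E]]. replace (probe g h t) with b; auto.
    extensionality x. extensionality i.
    apply (f_equal (fun f => f x i)) in E. unfold probe in *. lra.
  - intros H. exists (probe g h t). split; auto.
    extensionality x. extensionality i. unfold probe. ring.
Qed.

(** Makes the good sets of the main proof open and hence the exceptional set Borel. A slack of
    [2 * e] suffices since each of the two graph points moves by less than [e]. *)
Lemma graph_separated_open f n l : inC rho d f -> graph_separated rho d f n l ->
  exists e, 0 < e /\ forall g, inC rho d g -> cdist d f g < e -> graph_separated rho d g n l.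
Proof.
  intros Hf [Hl1 Hl2].
  destruct (list_uniform_radius (list_prod l l) (fun p e => fst p <> snd p ->
    (/2) ^ n + 2 * e < graph_dist rho d (fst p, f (fst p)) (snd p, f (snd p)))) as [e [He H]].
  - intros p e e' _ h he hp. specialize (h hp). lra.
  - intros [x y] Hp. apply in_prod_iff in Hp as [hx hy]. simpl.
    destruct (classic (x = y)) as [E|hn]; [exists 1; split; [lra|tauto]|].
    specialize (Hl2 x y hx hy hn).
    exists ((graph_dist rho d (x, f x) (y, f y) - (/2) ^ n) / 4). split; [lra|]. intros _. lra.
  - exists e. split; auto. intros g Hg Hd. split; auto. intros x y hx hy hn.
    assert (Hmove : forall z, graph_dist rho d (z, f z) (z, g z) < e).
    { intros z. eapply Rle_lt_trans; [apply (graph_dist_le rho Hmet)|]. simpl.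
      rewrite (metric_refl rho Hmet).
      pose proof (proj1 (cdist_lub rho Hmet d Hcpt x0 f g Hf Hg) z). lra. }
    assert (In (x, y) (list_prod l l)) as Hp by (apply in_prod_iff; auto).
    specialize (H (x, y) Hp hn). simpl in H.
    destruct (graph_dist_pseudometric rho Hmet d) as [_ [Gs Gt]].
    pose proof (Gt (x, f x) (x, g x) (y, f y)). pose proof (Gt (x, g x) (y, g y) (y, f y)).
    pose proof (Hmove x). pose proof (Hmove y). rewrite (Gs (y, g y) (y, f y)) in *. lra.
Qed.

End Collisions.

(** * The exceptional set and the conclusion *)

(** The levels must stay strictly below [D] for the kernels to exist, and must still exhaust [D]
    after the loss [/ (INR k + 1)] caused by the coarser grid. For [D = Finite 0] they are
    negative. *)
Lemma dimension_approximation D : Rbar_le (Finite 0) D ->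
  exists s : nat -> R, (forall k, ~ Rbar_le D (Finite (s k))) /\
    forall v, ~ Rbar_le D (Finite v) -> exists k, v < s k - / (INR k + 1).
Proof.
  intros HD. destruct D as [r| |]; simpl in HD; [| |tauto].
  - exists (fun k => r - / (INR k + 1)). split.
    + intros k. simpl. assert (0 < / (INR k + 1)); [|lra].
      apply Rinv_0_lt_compat. pose proof (pos_INR k). lra.
    + intros v Hv. simpl in Hv. apply Rnot_le_lt in Hv.
      destruct (INR_unbounded (2 / (r - v))) as [k Hk]. exists k. pose proof (pos_INR k).
      assert (2 * / (INR k + 1) < r - v); [|lra].
      apply Rmult_lt_reg_r with (INR k + 1); [lra|]. rewrite Rmult_assoc, Rinv_l by lra.
      assert (2 = 2 / (r - v) * (r - v)) as E by (field; lra).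
      assert (2 / (r - v) * (r - v) < (INR k + 1) * (r - v)) by (apply Rmult_lt_compat_r; lra).
      lra.
  - exists INR. split; [intros k; simpl; tauto|]. intros v _.
    destruct (INR_unbounded (v + 1)) as [k Hk]. exists k. pose proof (pos_INR k).
    assert (/ (INR k + 1) <= 1); [|lra]. rewrite <- Rinv_1. apply Rinv_le_contravar; lra.
Qed.

Theorem theorem1p12 (X : Type) (rho : X -> X -> R)
  (Hmet : is_metric rho) (Hcpt : m_compact rho) (Hunc : uncountable X)
  (d : nat) (Hd : (1 <= d)%nat) :
  exists P : (X -> nat -> R) -> Prop,
    prevalent rho d P /\
    forall f, P f ->
      packing_dim (graph_dist rho d) (graph f) =
      Rbar_plus (packing_dim rho (fun _ => True)) (Finite (INR d)).
Proof.
  assert (inhabited X) as [x0].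
  { apply NNPP. intros Hn. apply Hunc. exists (fun _ => O). intros x. exfalso. auto. }
  set (D := packing_dim rho (fun _ => True)).
  assert (HD : Rbar_le (Finite 0) D).
  { apply packing_dim_ge. intros A v _ Hv.
    apply (upper_box_dim_nonneg rho (metric_pseudometric rho Hmet) (A 0%nat)). auto. }
  destruct (dimension_approximation D HD) as [s [Hs1 Hs2]].
  destruct (countable_base_exists rho Hmet Hcpt) as [V HV].
  destruct (choice (fun k C => nonempty_set C /\ m_open rho (fun x => ~ C x) /\
    forall v, nonempty_set (fun x => V v x /\ C x) -> rich rho (s k) (fun x => V v x /\ C x)))
    as [C HC].
  { intros k. apply (kernel_exists rho Hmet Hcpt V (s k) HV).
    apply (whole_space_not_small rho Hmet x0); auto. }
  (* [q] codes a level and a base set, so that one countable family contains the pieces of all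
     kernels. *)
  set (S := fun q x => V (snd (of_nat q)) x /\ C (fst (of_nat q)) x).
  set (eta := fun k => / (INR k + 1)).
  destruct (generic_map rho Hmet Hcpt d Hd x0 S (fun q => s (fst (of_nat q)))
    (fun q => eta (fst (of_nat q)))) as [g [Hg Hspread]].
  { intros q. apply HC. }
  { intros q. unfold eta. apply Rinv_0_lt_compat. pose proof (pos_INR (fst (of_nat q))). lra. }
  set (O := fun q N f => inC rho d f /\ (nonempty_set (S q) -> exists n l, (N <= n)%nat /\
    (forall x, In x l -> S q x) /\ graph_separated rho d f n l /\
    Rpower 2 (INR n * (s (fst (of_nat q)) - eta (fst (of_nat q)) + INR d)) <= INR (length l))).
  assert (HO : forall q N, C_open rho d (O q N)).
  { intros q N. split; [intros f [h _]; auto|]. intros f [Hf H].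
    destruct (classic (nonempty_set (S q))) as [hne|hne].
    - destruct (H hne) as [n [l [H1 [H2 [H3 H4]]]]].
      destruct (graph_separated_open rho Hmet Hcpt d x0 f n l Hf H3) as [e [He Ho]].
      exists e. split; auto. intros f' Hf' Hc. split; auto. intros _. exists n, l. auto.
    - exists 1. split; [lra|]. intros f' Hf' _. split; auto. tauto. }
  set (bad := fun f => exists p, inC rho d f /\ ~ O (fst (of_nat p)) (snd (of_nat p)) f).
  exists (fun f => inC rho d f /\ forall q N, O q N f). split.
  - split; [tauto|].
    destruct (CubeMeasure.cube_law_exists d) as [Meas [lam HL]].
    exists bad, (fun A : (X -> nat -> R) -> Prop => lam (fun t => A (probe g (fun _ _ => 0) t))).
    split; [|split; [|split]].
    + apply Borel_union. intros p. apply Borel_compl, Borel_open. apply HO.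
    + intros f [Hf Hn]. apply NNPP. intros Hb. apply Hn. split; auto.
      intros q N. apply NNPP. intros Hq. apply Hb. exists (to_nat (q, N)).
      rewrite cancel_of_to. auto.
    + apply (probe_law_Borel_prob rho Hmet Hcpt d x0 Meas lam HL g Hg).
    + intros h Hh.
      replace (fun t => translate bad h (probe g (fun _ _ => 0) t))
        with (fun t => exists p, (fun p t => inC rho d (probe g h t) /\
          ~ O (fst (of_nat p)) (snd (of_nat p)) (probe g h t)) p t)
        by (apply pred_ext; intros t; rewrite translate_probe; reflexivity).
      assert (HM : forall p, Meas (fun t => inC rho d (probe g h t) /\
          ~ O (fst (of_nat p)) (snd (of_nat p)) (probe g h t))).
      { intros p. apply (probe_measurable rho Hmet Hcpt d x0 Meas lam HL g h
          (fun f => inC rho d f /\ ~ O (fst (of_nat p)) (snd (of_nat p)) f) Hg Hh).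
        apply Borel_compl, Borel_open. apply HO. }
      apply (lam_null_union d Meas lam HL); auto.
      intros p. set (q := fst (of_nat p)) in *. set (N := snd (of_nat p)) in *.
      set (Z := fun t => inC rho d (probe g h t) /\ ~ O q N (probe g h t)).
      assert (MZ : Meas Z) by apply (HM p).
      apply Rle_antisym; [|apply (cl_ge0 _ _ _ HL); auto].
      destruct (classic (nonempty_set (S q))) as [hne|hne].
      * apply Rnot_lt_le. intros Hpos.
        (* The scales beyond [N + N'] are also beyond [N], so the same [Z] satisfies the bound
           [2 / (INR (N + N') + 1)], which is below [lam Z]. *)
        destruct (INR_unbounded (2 / lam Z)) as [N' HN'].
        destruct (Hspread q (N + N')%nat hne) as [n [k [J [w [x [Hbud Hspr]]]]]].
        assert (lam Z <= 2 / (INR (N + N') + 1)) as Hle.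
        { apply (lam_few_separated_le rho Hmet d Meas lam HL g h (S q) _ _ _ n k J w x Z Hspr Hbud MZ).
          intros t [Ht1 Ht2] l Hl1 Hl2. apply Rnot_le_lt. intros Hlen. apply Ht2.
          split; auto. intros _. exists n, l. repeat (split; auto).
          destruct Hbud as [hn _]. lia. }
        rewrite plus_INR in Hle. pose proof (pos_INR N). pose proof (pos_INR N').
        apply (Rmult_le_compat_r (INR N + INR N' + 1)) in Hle; [|lra].
        unfold Rdiv in Hle. rewrite (Rmult_assoc 2), Rinv_l in Hle by lra.
        assert (2 = 2 / lam Z * lam Z) as E by (field; lra).
        assert (2 / lam Z * lam Z < (INR N + INR N' + 1) * lam Z) by (apply Rmult_lt_compat_r; lra).
        lra.
      * replace Z with (fun _ : nat -> R => False); [rewrite (lam_false _ _ _ HL); lra|].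
        apply pred_ext. intros t. split; [tauto|]. intros [h1 h2]. apply h2. split; auto. tauto.
  - intros f [Hf HP]. apply Rbar_le_antisym.
    + apply (packing_dim_graph_le rho Hmet Hcpt d); auto.
    + apply packing_dim_ge. intros A v HA Hv. apply NNPP. intros Hlt.
      assert (~ Rbar_le D (Finite (v - INR d))) as HDv.
      { intros h. apply Hlt. destruct D as [r| |]; simpl in *; auto. lra. }
      (* [k] is such that [s k] exceeds [v - INR d] even after the loss [eta k]; the Baire argument
         in [C k] contradicts this. *)
      destruct (Hs2 _ HDv) as [k Hk]. fold (eta k) in Hk. destruct (HC k) as [HC1 [HC2 _]].
      assert (s k - eta k + INR d <= v); [|lra].
      apply (graph_cover_dim_ge rho Hmet Hcpt d V (C k) f (s k - eta k)) with (A := A); auto.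
      intros j Hne N. destruct (HP (to_nat (k, j)) N) as [_ H].
      unfold S in H. rewrite cancel_of_to in H. simpl in H. auto.
Qed.
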